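(* Let $\mathcal{A}$ be a semi-abelian category, $\mathcal{B}$ a Birkhoff subcategory of $\mathcal{A}$ with reflector $I\colon\mathcal{A}\to\mathcal{B}$ and inclusion $H$, and $\mathcal{F}$ a regular epi-reflective subcategory of $\mathcal{B}$ with reflector $F\colon\mathcal{B}\to\mathcal{F}$ and inclusion $U$, such that $\mathcal{F}$ is admissible for the class of regular epimorphisms in $\mathcal{B}$ and $F$ is protoadditive. Let $B$ be an object of $\mathcal{A}$ and $f\colon P\to B$ a projective presentation of $B$. Then the fundamental group $\pi_1(B)$ of $B$ relative to the composite adjunction $F\circ I\dashv H\circ U$ is given by $$\pi_1(B)\;\cong\;\frac{K[f]\wedge\overline{([P,P]_{\mathcal{B}})}^{\mathcal{F}}_{P}}{\overline{([K[f],P]_{\mathcal{B}})}^{\mathcal{F}}_{K[f]}}.$$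
   Context: Conventions. A category is semi-abelian if it is pointed (zero object $0$), Barr-exact, protomodular and has binary coproducts; it is homological if it is pointed, finitely complete, regular and protomodular. All subcategories are full and replete. A reflective subcategory is regular epi-reflective if the components of the unit are regular epimorphisms. A Birkhoff subcategory is a regular epi-reflective subcategory stable under regular quotients. $K[g]$ denotes the domain of the kernel $\ker(g)$ of a morphism $g$; $\wedge$ is the intersection (meet) of subobjects. A functor is protoadditive if it preserves split short exact sequences. Galois structures. Let $\mathcal{X}$ be a reflective subcategory of a category $\mathcal{C}$ with reflector $L\colon\mathcal{C}\to\mathcal{X}$, inclusion $J$, unit $\eta$ and counit $\epsilon$, and let $\mathcal{E}$ be a class of morphisms of $\mathcal{C}$ with $JL(\mathcal{E})\subseteq\mathcal{E}$, such that $\mathcal{C}$ has all pullbacks along morphisms in $\mathcal{E}$, and $\mathcal{E}$ contains all isomorphisms, is closed under composition and is pullback-stable; this is a Galois structure. $\mathcal{C}\downarrow B$ is the full subcategory of the slice $\mathcal{C}/B$ on the arrows in $\mathcal{E}$, and $\mathcal{X}\downarrow L(B)$ the full subcategory of $\mathcal{X}/L(B)$ on the arrows in $\mathcal{E}$. The structure is admissible if for every $B$ the functor $J^B\colon\mathcal{X}\downarrow L(B)\to\mathcal{C}\downarrow B$, sending $\phi\colon X\to L(B)$ to the pullback of $J(\phi)$ along $\eta_B\colon B\to JL(B)$, is fully faithful. ''$\mathcal{F}$ is admissible for the class of regular epimorphisms in $\mathcal{B}$'' means that the Galois structure given by $F\dashv U$ and the regular epimorphisms of $\mathcal{B}$ is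 admissible. Write $\eta$ for the unit of the composite adjunction $F\circ I\dashv H\circ U$ between $\mathcal{A}$ and $\mathcal{F}$, $\eta^1$ for the unit of $I\dashv H$, and $\mathcal{E}$ for the class of regular epimorphisms of $\mathcal{A}$. With respect to the Galois structure given by $F\circ I\dashv H\circ U$ and $\mathcal{E}$: a regular epimorphism $p\colon E\to B$ in $\mathcal{A}$ is a trivial extension if the naturality square of $\eta$ at $p$ (with vertical maps $p$ and $FI(p)$ and horizontal maps $\eta_E,\eta_B$) is a pullback; it is a normal extension if the pullback $p^*(p)$ of $p$ along itself is a trivial extension. (In a Barr-exact category every regular epimorphism is a monadic extension.) A normal extension $p\colon E\to B$ is weakly universal if for every normal extension $p'\colon E'\to B$ there is a morphism $u\colon E\to E'$ with $p=p'\circ u$. Fundamental group. For a normal extension $p\colon E\to B$ with kernel pair projections $\pi_1,\pi_2\colon E\times_B E\to E$, the Galois group $\mathsf{Gal}(E,p,0)$ is the kernel (object) of $\langle FI(\pi_1),FI(\pi_2)\rangle\colon FI(E\times_BE)\to FI(E)\times FI(E)$ (it carries a unique internal group structure). The fundamental group $\pi_1(B)$ is the Galois group of any weakly universal normal extension of $B$; it is independent, up to isomorphism, of the choice. A projective presentation of $B$ is a regular epimorphism $f\colon P\to B$ in $\mathcal{A}$ with $P$ projective with respect to $\mathcal{E}$. Closure. For a regular epi-reflective subcategory $\mathcal{X}$ of a homological category $\mathcal{C}$, with unit $\eta$, and a normal subobject $K\to A$ with quotient $q_K\colon A\to A/K$, the closure is $\overline{K}^{\mathcal{X}}_A=q_K^{-1}(K[\eta_{A/K}])$,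 the pullback of $\ker(\eta_{A/K})$ along $q_K$; in particular $\overline{0}^{\mathcal{X}}_A=K[\eta_A]$. Here $\overline{(\cdot)}^{\mathcal{F}}$ is the closure for the reflector $F\circ I\colon\mathcal{A}\to\mathcal{F}$. Relative commutator. For a regular epimorphism $f\colon A\to B$ in $\mathcal{A}$ with kernel pair $\pi_1,\pi_2\colon R[f]\to A$, let $\hat\pi_1,\hat\pi_2\colon\overline{0}^{\mathcal{B}}_{R[f]}=K[\eta^1_{R[f]}]\to\overline{0}^{\mathcal{B}}_A=K[\eta^1_A]$ be the restrictions of $\pi_1,\pi_2$. Then $[K[f],A]_{\mathcal{B}}$ is the domain of $\ker(\hat\pi_1)$, regarded as a normal subobject of $A$ (contained in $K[f]$) via the normal monomorphism $\ker(\eta^1_A)\circ\hat\pi_2\circ\ker(\hat\pi_1)$. Taking $B=0$ gives $[A,A]_{\mathcal{B}}$, and $[A,A]_{\mathcal{B}}=\overline{0}^{\mathcal{B}}_A$. In the formula, $[K[f],P]_{\mathcal{B}}$ in the denominator is viewed as a normal subobject of $K[f]$ and its closure is taken in $K[f]$. *)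

(* Defs.v *)
From mathcomp Require Import all_boot.

Set Implicit Arguments.
Unset Strict Implicit.
Unset Printing Implicit Defensive.

(* Limits, kernels, quotients and so on are unique only up to isomorphism, and
   no choice of them is made: each construction is a predicate "this object,
   with these morphisms, is a ...". *)

Record category : Type := Category {
  ob :> Type;
  hom : ob -> ob -> Type;
  idm : forall X : ob, hom X X;
  compose : forall X Y Z : ob, hom Y Z -> hom X Y -> hom X Z;
  compose1m : forall (X Y : ob) (f : hom X Y), compose (idm Y) f = f;
  composem1 : forall (X Y : ob) (f : hom X Y), compose f (idm X) = f;
  composeA : forall (W X Y Z : ob) (h : hom Y Z) (g : hom X Y) (f : hom W X),
    compose h (compose g f) = compose (compose h g) f
}.

Arguments hom {c} X Y : rename.
Arguments idm {c} X : rename.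
Arguments compose {c X Y Z} g f : rename.

Notation "g ∘ f" := (compose g f) (at level 40, left associativity).

Record functor (C D : category) : Type := Functor {
  fob :> C -> D;
  fmap : forall X Y : C, hom X Y -> hom (fob X) (fob Y);
  fmap_id : forall X : C, fmap (idm X) = idm (fob X);
  fmap_comp : forall (X Y Z : C) (g : hom Y Z) (f : hom X Y),
    fmap (g ∘ f) = fmap g ∘ fmap f
}.

Arguments fmap {C D} F {X Y} f : rename.

Definition comp_functor (C D E : category) (G : functor D E) (F : functor C D) :
  functor C E.
Proof.
refine (@Functor C E (fun X => G (F X)) (fun X Y f => fmap G (fmap F f)) _ _).
- by move=> X; rewrite !fmap_id.
- by move=> X Y Z g f; rewrite !fmap_comp.
Defined.

(* An adjunction [L -| J], presented by its unit. *)
Record adjunction (C X : category) (L : functor C X) (J : functor X C) : Type :=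
  Adjunction {
  adj_unit : forall A : C, hom A (J (L A));
  adj_unit_nat : forall (A B : C) (f : hom A B),
    fmap J (fmap L f) ∘ adj_unit A = adj_unit B ∘ f;
  adj_unit_univ : forall (A : C) (Y : X) (f : hom A (J Y)),
    exists! g : hom (L A) Y, fmap J g ∘ adj_unit A = f
}.

Definition comp_adjunction (C D E : category)
  (L1 : functor C D) (J1 : functor D C) (L2 : functor D E) (J2 : functor E D)
  (a1 : adjunction L1 J1) (a2 : adjunction L2 J2) :
  adjunction (comp_functor L2 L1) (comp_functor J1 J2).
Proof.
refine (@Adjunction _ _ (comp_functor L2 L1) (comp_functor J1 J2)
  (fun A => fmap J1 (adj_unit a2 (L1 A)) ∘ adj_unit a1 A) _ _).
- move=> A B f /=.
  rewrite composeA -fmap_comp adj_unit_nat fmap_comp -composeA adj_unit_nat.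
  by rewrite composeA.
- move=> A Y f.
  have [g [gP g_uniq]] := adj_unit_univ a1 (f : hom A (J1 (J2 Y))).
  have [h [hP h_uniq]] := adj_unit_univ a2 g.
  exists h; split=> [|h' /=]; first by rewrite /= composeA -fmap_comp hP.
  by rewrite composeA -fmap_comp => /g_uniq/esym/h_uniq.
Defined.

Definition full_sub (C : category) (P : C -> Prop) : category :=
  @Category {X : C | P X}
    (fun X Y => hom (proj1_sig X) (proj1_sig Y))
    (fun X => idm (proj1_sig X))
    (fun X Y Z g f => g ∘ f)
    (fun X Y f => compose1m f)
    (fun X Y f => composem1 f)
    (fun W X Y Z h g f => composeA h g f).

Definition incl (C : category) (P : C -> Prop) : functor (full_sub P) C :=
  @Functor (full_sub P) C (fun X => proj1_sig X) (fun X Y f => f)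
    (fun X => erefl) (fun X Y Z g f => erefl).

Section Notions.
Variable C : category.

Definition is_iso (X Y : C) (f : hom X Y) : Prop :=
  exists g : hom Y X, g ∘ f = idm X /\ f ∘ g = idm Y.

Definition isomorphic (X Y : C) : Prop := exists f : hom X Y, is_iso f.

(* Limit of the diagram with vertices [D] and arrows [d] over a directed graph;
   the limit of a functor is the limit of its underlying graph diagram. *)
Definition is_limit (V E : Type) (s t : E -> V) (D : V -> C)
  (d : forall e, hom (D (s e)) (D (t e))) (L : C) (pr : forall v, hom L (D v)) :
  Prop :=
  (forall e, d e ∘ pr (s e) = pr (t e)) /\
  forall (T : C) (a : forall v, hom T (D v)),
    (forall e, d e ∘ a (s e) = a (t e)) ->
    exists! h : hom T L, forall v, pr v ∘ h = a v.

Definition finitely_complete : Prop :=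
  forall (V E : finType) (s t : E -> V) (D : V -> C)
    (d : forall e, hom (D (s e)) (D (t e))),
    exists (L : C) (pr : forall v, hom L (D v)), is_limit d pr.

Definition is_zero (Z : C) : Prop :=
  forall X : C, (exists! f : hom X Z, True) /\ (exists! f : hom Z X, True).

Definition pointed : Prop := exists Z : C, is_zero Z.

Definition is_product (X Y P : C) (p1 : hom P X) (p2 : hom P Y) : Prop :=
  forall (T : C) (a : hom T X) (b : hom T Y),
    exists! h : hom T P, p1 ∘ h = a /\ p2 ∘ h = b.

Definition is_coproduct (X Y S : C) (i1 : hom X S) (i2 : hom Y S) : Prop :=
  forall (T : C) (a : hom X T) (b : hom Y T),
    exists! h : hom S T, h ∘ i1 = a /\ h ∘ i2 = b.

Definition has_binary_coproducts : Prop :=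
  forall X Y : C, exists (S : C) (i1 : hom X S) (i2 : hom Y S),
    is_coproduct i1 i2.

(*  P --p2--> Y
    |p1       |g
    v         v
    X --f---> Z   *)
Definition is_pullback (X Y Z P : C) (f : hom X Z) (g : hom Y Z)
  (p1 : hom P X) (p2 : hom P Y) : Prop :=
  f ∘ p1 = g ∘ p2 /\
  forall (T : C) (a : hom T X) (b : hom T Y), f ∘ a = g ∘ b ->
    exists! h : hom T P, p1 ∘ h = a /\ p2 ∘ h = b.

Definition is_kernel_pair (X Y R : C) (f : hom X Y) (r1 r2 : hom R X) : Prop :=
  is_pullback f f r1 r2.

Definition is_coequalizer (X Y Q : C) (u v : hom X Y) (q : hom Y Q) : Prop :=
  q ∘ u = q ∘ v /\
  forall (T : C) (a : hom Y T), a ∘ u = a ∘ v -> exists! h : hom Q T, h ∘ q = a.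

Definition regular_epi (X Y : C) (f : hom X Y) : Prop :=
  exists (W : C) (u v : hom W X), is_coequalizer u v f.

Definition zero_mor (X Y : C) (f : hom X Y) : Prop :=
  exists Z : C, is_zero Z /\ exists (u : hom X Z) (v : hom Z Y), f = v ∘ u.

Definition is_kernel (K X Y : C) (k : hom K X) (f : hom X Y) : Prop :=
  zero_mor (f ∘ k) /\
  forall (T : C) (a : hom T X), zero_mor (f ∘ a) -> exists! h : hom T K, k ∘ h = a.

Definition is_cokernel (K X Y : C) (k : hom K X) (f : hom X Y) : Prop :=
  zero_mor (f ∘ k) /\
  forall (T : C) (a : hom X T), zero_mor (a ∘ k) -> exists! h : hom Y T, h ∘ f = a.

(* [0 -> K -> X -> Y -> 0]: equivalently, [k] is a normal subobject of [X] and
   [f : X -> Y] is the quotient [X / K]. *)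
Definition short_exact (K X Y : C) (k : hom K X) (f : hom X Y) : Prop :=
  is_kernel k f /\ is_cokernel k f.

Definition split_short_exact (K X Y : C) (k : hom K X) (f : hom X Y)
  (s : hom Y X) : Prop :=
  short_exact k f /\ f ∘ s = idm Y.

Definition regular_category : Prop :=
  [/\ finitely_complete,
      forall (X Y R : C) (f : hom X Y) (r1 r2 : hom R X),
        is_kernel_pair f r1 r2 ->
        exists (Q : C) (q : hom X Q), is_coequalizer r1 r2 q &
      forall (X Y Z P : C) (f : hom X Z) (g : hom Y Z)
        (p1 : hom P X) (p2 : hom P Y),
        is_pullback f g p1 p2 -> regular_epi f -> regular_epi p2].

(* The generalized elements [a], [b] of [X] are related by [(r1, r2)]. *)
Definition related (X R : C) (r1 r2 : hom R X) (T : C) (a b : hom T X) : Prop :=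
  exists h : hom T R, r1 ∘ h = a /\ r2 ∘ h = b.

Definition equivalence_relation (X R : C) (r1 r2 : hom R X) : Prop :=
  [/\ forall (T : C) (h h' : hom T R),
        r1 ∘ h = r1 ∘ h' -> r2 ∘ h = r2 ∘ h' -> h = h',
      forall (T : C) (a : hom T X), related r1 r2 a a,
      forall (T : C) (a b : hom T X), related r1 r2 a b -> related r1 r2 b a &
      forall (T : C) (a b c : hom T X),
        related r1 r2 a b -> related r1 r2 b c -> related r1 r2 a c].

Definition barr_exact : Prop :=
  regular_category /\
  forall (X R : C) (r1 r2 : hom R X), equivalence_relation r1 r2 ->
    exists (Y : C) (f : hom X Y), is_kernel_pair f r1 r2.

(* Change of base along every [v : B' -> B], from points (split epimorphisms
   with a chosen section) over [B] to points over [B'], reflects isomorphisms: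
   [h] is the image of the morphism of points [g]. *)
Definition protomodular : Prop :=
  forall (B B' : C) (v : hom B' B)
    (X : C) (p : hom X B) (s : hom B X) (Y : C) (q : hom Y B) (t : hom B Y)
    (g : hom X Y),
  p ∘ s = idm B -> q ∘ t = idm B -> q ∘ g = p -> g ∘ s = t ->
  forall (X' : C) (x : hom X' X) (p' : hom X' B')
    (Y' : C) (y : hom Y' Y) (q' : hom Y' B') (h : hom X' Y'),
  is_pullback p v x p' -> is_pullback q v y q' ->
  y ∘ h = g ∘ x -> q' ∘ h = p' ->
  is_iso h -> is_iso g.

Definition semi_abelian : Prop :=
  [/\ pointed, barr_exact, protomodular & has_binary_coproducts].

Definition projective (P : C) : Prop :=
  forall (X Y : C) (e : hom X Y) (a : hom P Y), regular_epi e ->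
    exists b : hom P X, e ∘ b = a.

Definition projective_presentation (P B : C) (f : hom P B) : Prop :=
  regular_epi f /\ projective P.

Definition replete (S : C -> Prop) : Prop :=
  forall X Y : C, isomorphic X Y -> S X -> S Y.

End Notions.

Definition regular_epi_reflective (C : category) (S : C -> Prop)
  (L : functor C (full_sub S)) (adj : adjunction L (incl S)) : Prop :=
  replete S /\ forall A : C, regular_epi (adj_unit adj A).

Definition birkhoff (C : category) (S : C -> Prop)
  (L : functor C (full_sub S)) (adj : adjunction L (incl S)) : Prop :=
  regular_epi_reflective adj /\
  forall (X Y : C) (f : hom X Y), regular_epi f -> S X -> S Y.

Definition protoadditive (C D : category) (F : functor C D) : Prop :=
  forall (K X Y : C) (k : hom K X) (f : hom X Y) (s : hom Y X),
    split_short_exact k f s -> split_short_exact (fmap F k) (fmap F f) (fmap F s).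

Section Galois.
Variables (C X : category) (L : functor C X) (J : functor X C).
Variable adj : adjunction L J.
Let eta := adj_unit adj.

(* For arrows [phi], [phi'] over [L B] in the class [E], [P = J^B phi] and
   [P' = J^B phi'] are pullbacks along [eta B], and [J^B] sends a morphism [g]
   over [L B] to the unique [h] over [B] with [x' ∘ h = fmap J g ∘ x].  Full
   fidelity of [J^B] says that each [h] over [B] is of this form for a unique
   [g]. *)
Definition admissible (E : forall A B : C, hom A B -> Prop) : Prop :=
  forall (B : C) (Y Y' : X) (phi : hom Y (L B)) (phi' : hom Y' (L B)),
  E _ _ (fmap J phi) -> E _ _ (fmap J phi') ->
  forall (P P' : C) (x : hom P (J Y)) (b : hom P B)
    (x' : hom P' (J Y')) (b' : hom P' B),
  is_pullback (fmap J phi) (eta B) x b ->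
  is_pullback (fmap J phi') (eta B) x' b' ->
  forall h : hom P P', b' ∘ h = b ->
  exists! g : hom Y Y', phi' ∘ g = phi /\ x' ∘ h = fmap J g ∘ x.

Definition trivial_extension (A B : C) (p : hom A B) : Prop :=
  regular_epi p /\ is_pullback (eta B) (fmap J (fmap L p)) p (eta A).

Definition normal_extension (A B : C) (p : hom A B) : Prop :=
  regular_epi p /\
  forall (R : C) (r1 r2 : hom R A), is_kernel_pair p r1 r2 ->
    trivial_extension r1.

Definition weakly_universal_normal_extension (A B : C) (p : hom A B) : Prop :=
  normal_extension p /\
  forall (A' : C) (p' : hom A' B), normal_extension p' ->
    exists u : hom A A', p = p' ∘ u.

(* [m] is the morphism [<L r1, L r2> : L R -> L A x L A]. *)
Definition is_galois_group (A B : C) (p : hom A B) (G : X) : Prop :=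
  exists (R : C) (r1 r2 : hom R A) (Q : X) (q1 q2 : hom Q (L A))
    (m : hom (L R) Q) (k : hom G (L R)),
    [/\ is_kernel_pair p r1 r2, is_product q1 q2,
        q1 ∘ m = fmap L r1, q2 ∘ m = fmap L r2 & is_kernel k m].

Definition is_fundamental_group (B : C) (G : X) : Prop :=
  exists (A : C) (p : hom A B),
    weakly_universal_normal_extension p /\ is_galois_group p G.

(* [c] is the closure in [A] of the normal subobject [k]. *)
Definition is_closure (K A K' : C) (k : hom K A) (c : hom K' A) : Prop :=
  exists (Q : C) (q : hom A Q) (N : C) (n : hom N Q) (r : hom K' N),
    [/\ short_exact k q, is_kernel n (eta Q) & is_pullback q n c r].

(* [m : M -> A] is the subobject [[K[f], A]], relative to the reflector [L]. *)
Definition is_relative_commutator (A B M : C) (f : hom A B) (m : hom M A) :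
  Prop :=
  exists (R : C) (r1 r2 : hom R A) (KR KA : C) (kR : hom KR R) (kA : hom KA A)
    (h1 h2 : hom KR KA) (n : hom M KR),
    [/\ is_kernel_pair f r1 r2,
        is_kernel kR (eta R) /\ is_kernel kA (eta A),
        kA ∘ h1 = r1 ∘ kR /\ kA ∘ h2 = r2 ∘ kR,
        is_kernel n h1 & m = kA ∘ h2 ∘ n].

(* [m : M -> A] is the subobject [[A, A]]. *)
Definition is_absolute_commutator (A M : C) (m : hom M A) : Prop :=
  exists (Z : C) (f : hom A Z), is_zero Z /\ is_relative_commutator f m.

End Galois.

(* [Q] is the quotient of [K[f] /\ cl_P [P,P]] by [cl_K[f] [K[f],P]], for
   commutators relative to [adjI] and closures relative to [adj].  Here
   [k : K -> P] is the kernel of [f], [cP] is the closure of [mP] (which is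
   [[P,P]]) in [P], and [cK] is the closure in [K] of [mK] (which is [[K,P]]
   viewed as a subobject of [K]); [N] is the meet, a subobject of [K] via [nK],
   and [j] is the inclusion of the denominator into it. *)
Definition is_hopf_quotient (A D X : category)
  (I : functor A D) (H : functor D A) (adjI : adjunction I H)
  (L : functor A X) (J : functor X A) (adj : adjunction L J)
  (P B : A) (f : hom P B) (Q : A) : Prop :=
  exists (K : A) (k : hom K P)
    (MP : A) (mP : hom MP P) (CP : A) (cP : hom CP P)
    (MK : A) (mK : hom MK K) (CK : A) (cK : hom CK K)
    (N : A) (nK : hom N K) (nP : hom N CP)
    (j : hom CK N) (q : hom N Q),
    [/\ is_kernel k f,
        is_absolute_commutator adjI mP /\ is_closure adj mP cP,
        is_relative_commutator adjI f (k ∘ mK) /\ is_closure adj mK cK,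
        is_pullback k cP nK nP &
        nK ∘ j = cK /\ short_exact j q].

(* Main.v *)
From mathcomp Require Import all_boot.
Require Import Defs.

Set Implicit Arguments.
Unset Strict Implicit.
Unset Printing Implicit Defensive.

(** Write [eta] for the unit of the composite adjunction and [G] for its
    reflector, seen as an endofunctor of [A].  Morphisms [T -> X] are treated as
    elements of [X]; an element [y] goes to zero under [f] when [f ∘ y] is a zero
    morphism.  For a regular epimorphism [f : P -> B] with kernel pair [R] and
    kernel [K], everything is controlled by one subobject of [K], namely
      C = {y in K : eta_R (0, y) = 0}.

    The key fact is that for a split epimorphism [p : R -> E] the comparison
    [K[p] -> K[G p]] is a regular epimorphism ([split_kernel_cover],
    [composite_unit_covers]).  It is a composite [K[p] -> K[I p] -> F K[I p]]:
    the first map is a regular epimorphism because regular epimorphisms between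
    split epimorphisms restrict to regular epimorphisms between their kernels,
    the second is a component of the unit of [F], and [F K[I p]] is [K[G p]]
    because [F] is protoadditive.  Applied to a kernel pair projection, this
    shows that a regular epimorphism is a normal extension as soon as its
    subobject [C] is zero ([normal_extension_of_kernel]): the comparison of
    kernels is then an isomorphism, so that the naturality square is a pullback.

    On [P] consider the relation of pairs [(x, y)] in [R] with
    [eta_R (x, y) = eta_R (x, x)].  It is reflexive, hence an equivalence
    relation, hence effective; let [q : P -> E] be its quotient, so that [f]
    factors as [p ∘ q], and [q] has kernel [C].  Then [p] is the universal normal
    extension under [f] ([normal_extension_reflection]); since [P] is projective,
    [p] is weakly universal among all normal extensions of [B].

    For a normal extension [p : E -> B] the pullback square identifies [K[G pi_1]]
    with [K[p]] and the restriction of [G pi_2] to it with [eta_E].  The Galois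
    group is therefore the meet of [K[p]] and [K[eta_E]]
    ([galois_group_joint_kernel]).  Two morphisms over [B] between normal
    extensions agree on this meet, so it depends only on [B]
    ([joint_kernel_isomorphic]).

    On the commutator side, the closure of [[P, P]] in [P] is [K[eta_P]]
    ([unit_closure_kernel]) and the closure of [[K, P]] in [K] is [C]
    ([commutator_closure_kernel]).  Finally [q] restricts to a regular
    epimorphism from the meet of [K] and [K[eta_P]] onto the meet of [K[p]] and
    [K[eta_E]], and the kernel of this restriction is [C]
    ([meet_quotient_short_exact]); this is the formula. *)

(** * Morphisms, kernels and zero morphisms *)

Section Basics.
Variable C : category.

Definition mono (X Y : C) (m : hom X Y) : Prop :=
  forall (T : C) (a b : hom T X), m ∘ a = m ∘ b -> a = b.

(** Rewriting with an equation between composites, up to associativity: composites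
    are kept in the form in which each morphism is applied to an element. *)
Lemma compose_eq (X Y Z : C) (g : hom Y Z) (f : hom X Y) (h : hom X Z) :
  g ∘ f = h -> forall (W : C) (x : hom W X), g ∘ (f ∘ x) = h ∘ x.
Proof. by move=> <- W x; rewrite composeA. Qed.

Lemma mono_of_comp (X Y Z : C) (g : hom Y Z) (f : hom X Y) :
  mono (g ∘ f) -> mono f.
Proof. by move=> gf_mono T a b eq_ab; apply: gf_mono; rewrite -!composeA eq_ab. Qed.

Lemma mono_comp (X Y Z : C) (g : hom Y Z) (f : hom X Y) :
  mono g -> mono f -> mono (g ∘ f).
Proof. by move=> gm fm T a b; rewrite -!composeA => /gm/fm. Qed.

Lemma iso_mono (X Y : C) (f : hom X Y) : is_iso f -> mono f.
Proof.
move=> [g [gf _]] T a b eq_ab.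
by rewrite -(compose1m a) -(compose1m b) -gf -!composeA eq_ab.
Qed.

Lemma mono_split_iso (X Y : C) (m : hom X Y) (d : hom Y X) :
  mono m -> m ∘ d = idm Y -> is_iso m.
Proof.
move=> m_mono md; exists d; split=> //.
by apply: m_mono; rewrite (compose_eq md) compose1m composem1.
Qed.

Lemma isomorphic_trans (X Y Z : C) :
  isomorphic X Y -> isomorphic Y Z -> isomorphic X Z.
Proof.
move=> [f [g [gf fg]]] [f' [g' [gf' fg']]]; exists (f' ∘ f), (g ∘ g').
split; rewrite -composeA.
  by rewrite (compose_eq gf') compose1m.
by rewrite (compose_eq fg) compose1m.
Qed.

Lemma zero_mor_compl (X Y Z : C) (g : hom Y Z) (f : hom X Y) :
  zero_mor f -> zero_mor (g ∘ f).
Proof.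
by move=> [O [O0 [u [v ->]]]]; exists O; split=> //;
  exists u, (g ∘ v); rewrite composeA.
Qed.

Lemma zero_mor_compr (X Y Z : C) (g : hom Y Z) (f : hom X Y) :
  zero_mor g -> zero_mor (g ∘ f).
Proof.
by move=> [O [O0 [u [v ->]]]]; exists O; split=> //;
  exists (u ∘ f), v; rewrite composeA.
Qed.

Lemma terminal_uniq (Z X : C) (f g : hom X Z) : is_zero Z -> f = g.
Proof. by move=> /(_ X)[[h [_ h_uniq]] _]; rewrite -(h_uniq f) // -(h_uniq g). Qed.

Lemma initial_uniq (Z X : C) (f g : hom Z X) : is_zero Z -> f = g.
Proof. by move=> /(_ X)[_ [h [_ h_uniq]]]; rewrite -(h_uniq f) // -(h_uniq g). Qed.

Lemma zero_mor_uniq (X Y : C) (f g : hom X Y) : zero_mor f -> zero_mor g -> f = g.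
Proof.
move=> [Z [Z0 [u [v ->]]]] [Z' [Z'0 [u' [v' ->]]]].
have [_ [c _]] := Z0 Z'.
by rewrite (initial_uniq v (v' ∘ c) Z0) (terminal_uniq u' (c ∘ u) Z'0) composeA.
Qed.

Lemma regular_epi_epi (X Y : C) (e : hom X Y) : regular_epi e ->
  forall (T : C) (a b : hom Y T), a ∘ e = b ∘ e -> a = b.
Proof.
move=> [W [u [v [euv e_univ]]]] T a b eq_ab.
have [|h [_ h_uniq]] := e_univ T (a ∘ e); first by rewrite -!composeA euv.
by rewrite -(h_uniq a) // -(h_uniq b).
Qed.

Lemma split_epi_regular (X Y : C) (f : hom X Y) (s : hom Y X) :
  f ∘ s = idm Y -> regular_epi f.
Proof.
move=> fs; exists X, (s ∘ f), (idm X); split=> [|T a].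
  by rewrite (compose_eq fs) compose1m composem1.
rewrite composem1 => asf; exists (a ∘ s); split=> [|h <-]; first by rewrite -composeA.
by rewrite -composeA fs composem1.
Qed.

Lemma regular_epi_mono_iso (X Y : C) (e : hom X Y) :
  regular_epi e -> mono e -> is_iso e.
Proof.
move=> e_reg e_mono; have [W [u [v [euv e_univ]]]] := e_reg.
have [|d [de _]] := e_univ X (idm X); first by rewrite (e_mono _ _ _ euv).
exists d; split=> //; apply: (regular_epi_epi e_reg).
by rewrite -composeA de composem1 compose1m.
Qed.

Lemma regular_epi_strong (X Y Q Z : C) (e : hom X Y) (m : hom Q Z)
  (a : hom X Q) (b : hom Y Z) :
  regular_epi e -> mono m -> m ∘ a = b ∘ e -> exists d : hom Y Q, d ∘ e = a.
Proof.
move=> [W [u [v [euv e_univ]]]] m_mono ma.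
have [|d [de _]] := e_univ Q a; last by exists d.
by apply: m_mono; rewrite !composeA ma -!composeA euv.
Qed.

Lemma regular_epi_extremal (X Y Q : C) (e : hom X Y) (m : hom Q Y) (a : hom X Q) :
  regular_epi e -> mono m -> m ∘ a = e -> is_iso m.
Proof.
move=> e_reg m_mono ma.
have [|d de] := regular_epi_strong (a := a) (b := idm Y) e_reg m_mono.
  by rewrite compose1m.
apply: (mono_split_iso (d := d)) => //; apply: (regular_epi_epi e_reg).
by rewrite -composeA de compose1m.
Qed.

Lemma iso_comp_regular_epi (X Y Z : C) (i : hom Y Z) (e : hom X Y) :
  is_iso i -> regular_epi e -> regular_epi (i ∘ e).
Proof.
move=> [j [ji ij]] [W [u [v [euv e_univ]]]]; exists W, u, v.
split=> [|T a auv]; first by rewrite -!composeA euv.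
have [h [he h_uniq]] := e_univ T a auv.
exists (h ∘ j); split=> [|h']; first by rewrite -composeA (compose_eq ji) compose1m.
by rewrite composeA => /h_uniq ->; rewrite -composeA ij composem1.
Qed.

Lemma pullback_mono (X Y Z P T : C) (f : hom X Z) (g : hom Y Z)
  (p1 : hom P X) (p2 : hom P Y) (a b : hom T P) :
  is_pullback f g p1 p2 -> p1 ∘ a = p1 ∘ b -> p2 ∘ a = p2 ∘ b -> a = b.
Proof.
move=> [sq p_univ] ab1 ab2.
have [|h [_ h_uniq]] := p_univ T (p1 ∘ a) (p2 ∘ a); first by rewrite !composeA sq.
by rewrite -(h_uniq a) // -(h_uniq b).
Qed.

Lemma pullback_lift (X Y Z P T : C) (f : hom X Z) (g : hom Y Z)
  (p1 : hom P X) (p2 : hom P Y) (a : hom T X) (b : hom T Y) :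
  is_pullback f g p1 p2 -> f ∘ a = g ∘ b ->
  exists h : hom T P, p1 ∘ h = a /\ p2 ∘ h = b.
Proof. by move=> [_ p_univ] /p_univ[h [hP _]]; exists h. Qed.

Lemma pullbackI (X Y Z P : C) (f : hom X Z) (g : hom Y Z)
  (p1 : hom P X) (p2 : hom P Y) :
  f ∘ p1 = g ∘ p2 ->
  (forall (T : C) (a b : hom T P), p1 ∘ a = p1 ∘ b -> p2 ∘ a = p2 ∘ b -> a = b) ->
  (forall (T : C) (a : hom T X) (b : hom T Y), f ∘ a = g ∘ b ->
    exists h : hom T P, p1 ∘ h = a /\ p2 ∘ h = b) ->
  is_pullback f g p1 p2.
Proof.
move=> sq p_mono p_lift; split=> // T a b /p_lift[h [h1 h2]].
exists h; split=> // h' [h1' h2'].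
by apply: p_mono; rewrite ?h1 ?h1' ?h2 ?h2'.
Qed.

Lemma kernel_mono (K X Y : C) (k : hom K X) (f : hom X Y) : is_kernel k f -> mono k.
Proof.
move=> [fk0 k_univ] T a b eq_ab.
have [|h [_ h_uniq]] := k_univ T (k ∘ a); first by rewrite composeA; exact: zero_mor_compr.
by rewrite -(h_uniq a) // -(h_uniq b).
Qed.

Lemma kernel_lift (K X Y T : C) (k : hom K X) (f : hom X Y) (a : hom T X) :
  is_kernel k f -> zero_mor (f ∘ a) -> exists h : hom T K, k ∘ h = a.
Proof. by move=> [_ k_univ] /k_univ[h [hP _]]; exists h. Qed.

Lemma kernelI (K X Y : C) (k : hom K X) (f : hom X Y) :
  zero_mor (f ∘ k) -> mono k ->
  (forall (T : C) (a : hom T X), zero_mor (f ∘ a) -> exists h : hom T K, k ∘ h = a) ->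
  is_kernel k f.
Proof.
move=> fk0 k_mono k_lift; split=> // T a /k_lift[h hP]; exists h; split=> // h' h'P.
by apply: k_mono; rewrite hP.
Qed.

Lemma kernel_zero (K X Y T : C) (k : hom K X) (f : hom X Y) (y : hom T K) :
  is_kernel k f -> zero_mor (f ∘ (k ∘ y)).
Proof. by move=> [fk0 _]; rewrite composeA; exact: zero_mor_compr. Qed.

Lemma kernel_congr (K X Y Y' : C) (k : hom K X) (f : hom X Y) (f' : hom X Y') :
  (forall (T : C) (y : hom T X), zero_mor (f ∘ y) <-> zero_mor (f' ∘ y)) ->
  is_kernel k f -> is_kernel k f'.
Proof.
by move=> ff' [fk0 k_univ]; split=> [|T a /ff'/k_univ//]; apply/ff'.
Qed.

Lemma kernel_isomorphic (K K' X Y : C) (k : hom K X) (k' : hom K' X) (f : hom X Y) :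
  is_kernel k f -> is_kernel k' f -> exists i : hom K K', is_iso i /\ k' ∘ i = k.
Proof.
move=> kP k'P; have [i iP] := kernel_lift k'P kP.1; have [j jP] := kernel_lift kP k'P.1.
exists i; split=> //; exists j.
split; [apply: (kernel_mono kP) | apply: (kernel_mono k'P)].
  by rewrite (compose_eq jP) iP composem1.
by rewrite (compose_eq iP) jP composem1.
Qed.

Lemma cokernel_isomorphic (K X Q Q' : C) (k : hom K X) (q : hom X Q) (q' : hom X Q') :
  is_cokernel k q -> is_cokernel k q' -> exists i : hom Q Q', is_iso i /\ i ∘ q = q'.
Proof.
move=> [qk q_univ] [q'k q'_univ].
have [i [iq _]] := q_univ _ _ q'k; have [j [jq' _]] := q'_univ _ _ qk.
have [h [_ h_uniq]] := q_univ _ _ qk; have [h' [_ h'_uniq]] := q'_univ _ _ q'k.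
exists i; split=> //; exists j; split.
  rewrite -(h_uniq (j ∘ i)) ?(h_uniq (idm Q)) ?compose1m //.
  by rewrite -composeA iq.
rewrite -(h'_uniq (i ∘ j)) ?(h'_uniq (idm Q')) ?compose1m //.
by rewrite -composeA jq'.
Qed.

Lemma regular_epi_coequalizer (X Y R : C) (f : hom X Y) (r1 r2 : hom R X) :
  regular_epi f -> is_kernel_pair f r1 r2 -> is_coequalizer r1 r2 f.
Proof.
move=> [W [u [v [fuv f_univ]]]] rP; split=> [|T a ar]; first exact: rP.1.
have [h [h1 h2]] := pullback_lift rP fuv.
by apply: f_univ; rewrite -h1 -h2 !composeA ar.
Qed.

End Basics.

(** * Finite limits *)

Section FiniteLimits.
Variable C : category.
Hypothesis C_lim : finitely_complete C.

Lemma pullback_ex (X Y Z : C) (f : hom X Z) (g : hom Y Z) :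
  exists (P : C) (p1 : hom P X) (p2 : hom P Y), is_pullback f g p1 p2.
Proof.
have [P [pr [prC prU]]] := @C_lim (option bool) bool Some (fun=> None)
  (fun v => match v with None => Z | Some true => X | Some false => Y end)
  (fun e => match e with true => f | false => g end).
exists P, (pr (Some true)), (pr (Some false)); split=> [|T a b eq_ab].
  by rewrite (prC true) (prC false).
have [|h [hP h_uniq]] := prU T (fun v =>
  match v with None => f ∘ a | Some true => a | Some false => b end); first by case.
exists h; split=> [|h' [h1 h2]]; first by rewrite (hP (Some true)) (hP (Some false)).
by apply: h_uniq => -[[]|] //; rewrite -(prC true) -composeA h1.
Qed.

Lemma product_ex (X Y : C) :
  exists (P : C) (p1 : hom P X) (p2 : hom P Y), is_product p1 p2.
Proof.
have [P [pr [prC prU]]] := @C_lim bool void (fun=> true) (fun=> true)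
  (fun v => if v then X else Y) (fun e => match e with end).
exists P, (pr true), (pr false) => T a b.
have [|h [hP h_uniq]] := prU T (fun v => match v with true => a | false => b end);
  first by case.
exists h; split=> [|h' [h1 h2]]; first by rewrite (hP true) (hP false).
by apply: h_uniq => -[].
Qed.

Lemma equalizer_ex (X Y : C) (u v : hom X Y) :
  exists (E : C) (m : hom E X), [/\ mono m, u ∘ m = v ∘ m &
    forall (T : C) (a : hom T X), u ∘ a = v ∘ a -> exists h : hom T E, m ∘ h = a].
Proof.
have [E [pr [prC prU]]] := @C_lim bool bool (fun=> true) (fun=> false)
  (fun v => if v then X else Y) (fun e => match e with true => u | false => v end).
have eq_uv : u ∘ pr true = v ∘ pr true by rewrite (prC true) (prC false).
exists E, (pr true); split=> // [T a b eq_ab|T a eq_a].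
  have [|h [hP h_uniq]] := prU T (fun v => pr v ∘ a).
    by case; rewrite composeA; [rewrite (prC true) | rewrite (prC false)].
  rewrite -(h_uniq a) // -(h_uniq b) // => -[] //.
  by rewrite -!(prC true) -!composeA eq_ab.
have [|h [hP h_uniq]] := prU T (fun v => match v with true => a | false => u ∘ a end).
  by case.
by exists h; rewrite (hP true).
Qed.

Lemma kernel_pair_ex (X Y : C) (f : hom X Y) :
  exists (R : C) (r1 r2 : hom R X), is_kernel_pair f r1 r2.
Proof. exact: pullback_ex. Qed.

Hypothesis C_ptd : pointed C.

Lemma zero_mor_ex (X Y : C) : exists f : hom X Y, zero_mor f.
Proof.
have [Z Z0] := C_ptd; have [[u _] _] := Z0 X; have [_ [v _]] := Z0 Y.
by exists (v ∘ u), Z; split=> //; exists u, v.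
Qed.

Lemma mono_zero (X Y T : C) (m : hom X Y) (f : hom T X) :
  mono m -> zero_mor (m ∘ f) -> zero_mor f.
Proof.
move=> m_mono mf0; have [o o0] := zero_mor_ex T X.
suff -> : f = o by [].
by apply: m_mono; apply: zero_mor_uniq => //; exact: zero_mor_compl.
Qed.

Lemma epi_zero (X Y T : C) (e : hom X Y) (f : hom Y T) :
  regular_epi e -> zero_mor (f ∘ e) -> zero_mor f.
Proof.
move=> e_reg fe0; have [o o0] := zero_mor_ex Y T.
suff -> : f = o by [].
by apply: (regular_epi_epi e_reg); apply: zero_mor_uniq => //; exact: zero_mor_compr.
Qed.

Lemma kernel_ex (X Y : C) (f : hom X Y) : exists (K : C) (k : hom K X), is_kernel k f.
Proof.
have [o o0] := zero_mor_ex X Y; have [K [k [k_mono fk k_lift]]] := equalizer_ex f o.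
exists K, k; apply: kernelI => // [|T a fa0]; first by rewrite fk; exact: zero_mor_compr.
by apply: k_lift; apply: zero_mor_uniq => //; exact: zero_mor_compr.
Qed.

(** The element [y] of the kernel of [f] corresponds to the pair [(0, y)]. *)
Lemma kernel_pair_kernel (X Y R K : C) (f : hom X Y) (r1 r2 : hom R X) (k : hom K X) :
  is_kernel_pair f r1 r2 -> is_kernel k f ->
  exists kappa : hom K R, r2 ∘ kappa = k /\ is_kernel kappa r1.
Proof.
move=> rP kP; have [o o0] := zero_mor_ex K X.
have [|kappa [k1 k2]] := pullback_lift (a := o) (b := k) rP.
  by apply: zero_mor_uniq; [exact: zero_mor_compl | exact: kP.1].
exists kappa; split=> //; apply: kernelI => [||T a a1]; first by rewrite k1.
  by apply: (@mono_of_comp _ _ _ _ r2); rewrite k2; exact: kernel_mono kP.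
have [|h hP] := kernel_lift (a := r2 ∘ a) kP.
  by rewrite composeA -rP.1 -composeA; exact: zero_mor_compl.
exists h; apply: (pullback_mono rP); last by rewrite (compose_eq k2).
by apply: zero_mor_uniq; rewrite // composeA k1; exact: zero_mor_compr.
Qed.

Lemma kernel_pair_diagonal (X Y R : C) (f : hom X Y) (r1 r2 : hom R X) :
  is_kernel_pair f r1 r2 -> exists d : hom X R, r1 ∘ d = idm X /\ r2 ∘ d = idm X.
Proof. by move=> rP; exact: (pullback_lift rP). Qed.

End FiniteLimits.

(** * Regular categories *)

Section Regular.
Variable C : category.
Hypothesis C_reg : regular_category C.

Let C_lim : finitely_complete C. Proof. by case: C_reg. Qed.

(** A regular epimorphism is locally surjective: every element of its codomain lifts
    after passing to a cover of its domain.  Together with [regular_epi_of_comp]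
    this allows element arguments. *)
Lemma regular_epi_cover (X Y T : C) (e : hom X Y) (y : hom T Y) : regular_epi e ->
  exists (T' : C) (t : hom T' T) (x : hom T' X), regular_epi t /\ e ∘ x = y ∘ t.
Proof.
move=> e_reg; have [P [p1 [p2 pP]]] := pullback_ex C_lim e y.
by exists P, p2, p1; split; [case: C_reg => _ _; apply; eassumption | exact: pP.1].
Qed.

(** The coequalizer of the kernel pair of [f] is the image: two elements of it with
    the same image in [Y] lift, on a common cover, to a pair in the kernel pair. *)
Lemma image_ex (X Y : C) (f : hom X Y) :
  exists (Q : C) (e : hom X Q) (m : hom Q Y), [/\ regular_epi e, mono m & m ∘ e = f].
Proof.
have [R [r1 [r2 rP]]] := kernel_pair_ex C_lim f.
have [Q [e eP]] : exists (Q : C) (e : hom X Q), is_coequalizer r1 r2 e.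
  by case: C_reg => _ + _; apply; eassumption.
have e_reg : regular_epi e by exists R, r1, r2.
have [m [me _]] := eP.2 _ _ rP.1.
exists Q, e, m; split=> // T a b eq_ab.
have [T1 [t1 [x [t1_reg xP]]]] := regular_epi_cover a e_reg.
have [T2 [t2 [y [t2_reg yP]]]] := regular_epi_cover (b ∘ t1) e_reg.
apply: (regular_epi_epi t1_reg); apply: (regular_epi_epi t2_reg).
have [|h [h1 h2]] := pullback_lift (a := x ∘ t2) (b := y) rP.
  by rewrite -me -!composeA (compose_eq xP) yP -composeA (compose_eq eq_ab) !composeA.
by rewrite -yP -xP -composeA -h1 -h2 !composeA eP.1.
Qed.

Lemma regular_epi_of_comp (X Y Z : C) (g : hom Y Z) (f : hom X Y) :
  regular_epi (g ∘ f) -> regular_epi g.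
Proof.
move=> gf_reg; have [Q [e [m [e_reg m_mono me]]]] := image_ex g.
rewrite -me; apply: iso_comp_regular_epi => //.
by apply: (regular_epi_extremal (a := e ∘ f) gf_reg) => //; rewrite composeA me.
Qed.

Lemma regular_epi_comp (X Y Z : C) (g : hom Y Z) (f : hom X Y) :
  regular_epi g -> regular_epi f -> regular_epi (g ∘ f).
Proof.
move=> g_reg f_reg; have [Q [e [m [e_reg m_mono me]]]] := image_ex (g ∘ f).
have [d de] := regular_epi_strong f_reg m_mono me.
rewrite -me; apply: iso_comp_regular_epi => //.
apply: (regular_epi_extremal (a := d) g_reg) => //.
by apply: (regular_epi_epi f_reg); rewrite -composeA de me.
Qed.

End Regular.

(** * Protomodular categories *)

Section Homological.
Variable C : category.
Hypotheses (C_ptd : pointed C) (C_reg : regular_category C) (C_proto : protomodular C).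

Let C_lim : finitely_complete C. Proof. by case: C_reg. Qed.

(** Protomodularity for the change of base along [0 -> B], which sends a split
    epimorphism to its kernel. *)
Lemma split_short_five (B X Y K L : C) (p : hom X B) (s : hom B X)
  (q : hom Y B) (t : hom B Y) (g : hom X Y) (k : hom K X) (l : hom L Y)
  (a : hom K L) :
  p ∘ s = idm B -> q ∘ t = idm B -> q ∘ g = p -> g ∘ s = t ->
  is_kernel k p -> is_kernel l q -> l ∘ a = g ∘ k -> is_iso a -> is_iso g.
Proof.
move=> ps qt qg gs kP lP la a_iso.
have [Z Z0] := C_ptd; have [v0 _] := Z0 B.
have [_ [v _]] := Z0 B; have [[k' _] _] := Z0 K; have [[l' _] _] := Z0 L.
have zeroZ (W : C) (b : hom W Z) : zero_mor (v ∘ b).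
  by exists Z; split=> //; exists b, v.
have kernel_pullback (W M : C) (w : hom M W) (r : hom W B) (w' : hom M Z) :
    is_kernel w r -> is_pullback r v w w'.
  move=> wP; apply: pullbackI => [|T b c eq_w _|T b c rb].
  - exact: zero_mor_uniq wP.1 _.
  - exact: (kernel_mono wP).
  have [|h hP] := kernel_lift (a := b) wP; first by rewrite rb.
  by exists h; split=> //; exact: terminal_uniq.
apply: (C_proto ps qt qg gs (kernel_pullback _ _ _ _ k' kP)
  (kernel_pullback _ _ _ _ l' lP) la) => //.
exact: terminal_uniq.
Qed.

(** The domain of a split epimorphism is generated by its section and its kernel: a
    subobject containing both is everything.  All uses of protomodularity to prove
    that an equation or a relation holds everywhere go through this lemma. *)
Lemma section_kernel_cover (V W U K : C) (p : hom W V) (s : hom V W)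
  (k : hom K W) (m : hom U W) (s' : hom V U) (k' : hom K U) :
  p ∘ s = idm V -> is_kernel k p -> mono m -> m ∘ s' = s -> m ∘ k' = k -> is_iso m.
Proof.
move=> ps kP m_mono ms mk.
have k'P : is_kernel k' (p ∘ m).
  apply: kernelI => [||T a]; first by rewrite -composeA mk; exact: kP.1.
    by apply: (@mono_of_comp _ _ _ _ m); rewrite mk; exact: kernel_mono kP.
  rewrite -composeA => /(kernel_lift kP)[h kh]; exists h.
  by apply: m_mono; rewrite (compose_eq mk).
apply: (split_short_five (s := s') (k := k') (a := idm K) _ ps _ ms k'P kP) => //.
- by rewrite -composeA ms.
- by rewrite composem1.
- by exists (idm K); rewrite composem1.
Qed.

(** The diagonal of the kernel pair contains the kernel of the first projection,
    so it is the whole kernel pair. *)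
Lemma mono_of_zero_kernel (X Y : C) (f : hom X Y) :
  (forall (T : C) (y : hom T X), zero_mor (f ∘ y) -> zero_mor y) -> mono f.
Proof.
move=> f_ker.
have [R [r1 [r2 rP]]] := kernel_pair_ex C_lim f.
have [d [d1 d2]] := kernel_pair_diagonal rP.
have [K [k kP]] := kernel_ex C_lim C_ptd r1.
have [o o0] := zero_mor_ex C_ptd K X.
have d_iso : is_iso d.
  apply: (section_kernel_cover (p := r1) (s := d) (k := k) (s' := idm X) (k' := o)) => //.
  - by apply: (@mono_of_comp _ _ _ _ r1); rewrite d1 => T a b; rewrite !compose1m.
  - by rewrite composem1.
  have r1k0 := kP.1; have r2k0 : zero_mor (r2 ∘ k).
    by apply: f_ker; rewrite composeA -rP.1 -composeA; exact: zero_mor_compl.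
  by apply: (pullback_mono rP); apply: zero_mor_uniq => //;
     rewrite composeA; exact: zero_mor_compl.
have [e [_ de]] := d_iso.
have r12 : r1 = r2.
  by rewrite -(composem1 r1) -(composem1 r2) -de !composeA d1 d2.
by move=> T a b /(pullback_lift rP)[h [<- <-]]; rewrite r12.
Qed.

(** If [a] kills the kernel of [f], then the subobject of the kernel pair on which
    [a ∘ r1] and [a ∘ r2] agree contains the diagonal and all pairs [(0, y)]. *)
Lemma regular_epi_cokernel (K X Y : C) (k : hom K X) (f : hom X Y) :
  regular_epi f -> is_kernel k f -> is_cokernel k f.
Proof.
move=> f_reg kP; split=> [|T a ak0]; first exact: kP.1.
have [R [r1 [r2 rP]]] := kernel_pair_ex C_lim f.
have [kappa [kap2 kapP]] := kernel_pair_kernel C_ptd rP kP.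
have [d [d1 d2]] := kernel_pair_diagonal rP.
have [U [m [m_mono mE m_lift]]] := equalizer_ex C_lim (a ∘ r1) (a ∘ r2).
have [s' ms] : exists s', m ∘ s' = d.
  by apply: m_lift; rewrite -!composeA d1 d2.
have [k' mk] : exists k', m ∘ k' = kappa.
  apply: m_lift; rewrite -!composeA kap2; apply: zero_mor_uniq => //.
  by apply: zero_mor_compl; exact: kapP.1.
have [m' [_ mm']] := section_kernel_cover d1 kapP m_mono ms mk.
have [_ f_univ] := regular_epi_coequalizer f_reg rP; apply: f_univ.
by rewrite -(composem1 (a ∘ r1)) -(composem1 (a ∘ r2)) -mm' !(composeA _ m) mE.
Qed.

Lemma regular_epi_short_exact (K X Y : C) (k : hom K X) (f : hom X Y) :
  regular_epi f -> is_kernel k f -> short_exact k f.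
Proof. by move=> f_reg kP; split=> //; exact: regular_epi_cokernel. Qed.

Lemma regular_epi_factor (X Y T : C) (f : hom X Y) (a : hom X T) :
  regular_epi f ->
  (forall (W : C) (x : hom W X), zero_mor (f ∘ x) -> zero_mor (a ∘ x)) ->
  exists g : hom Y T, g ∘ f = a.
Proof.
move=> f_reg fa; have [K [k kP]] := kernel_ex C_lim C_ptd f.
have [g [gP _]] := (regular_epi_cokernel f_reg kP).2 _ _ (fa _ _ kP.1).
by exists g.
Qed.

(** Every relation is difunctional: from [x D y], [z D y] and [z D w] follows
    [x D w].  The configurations [(x, y, z, w)] form a split epimorphism over the
    configurations [(x, y, z)], with section [w = y] and with kernel the elements
    [(0, 0, 0, w)]; the conclusion holds on both. *)
Lemma relation_difunctional (D X Y : C) (d0 : hom D X) (d1 : hom D Y) :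
  (forall (T : C) (a b : hom T D), d0 ∘ a = d0 ∘ b -> d1 ∘ a = d1 ∘ b -> a = b) ->
  forall (T : C) (a b c : hom T D), d1 ∘ a = d1 ∘ b -> d0 ∘ b = d0 ∘ c ->
  exists d : hom T D, d0 ∘ d = d0 ∘ a /\ d1 ∘ d = d1 ∘ c.
Proof.
move=> d_mono T a b c ab bc.
have [V [va [vb vP]]] := pullback_ex C_lim d1 d1.
have [W [w [wc wP]]] := pullback_ex C_lim (d0 ∘ vb) d0.
(* [U] consists of the configurations in [W] for which the conclusion holds. *)
have [U1 [u1 [ud uP]]] := pullback_ex C_lim (d0 ∘ va ∘ w) d0.
have [U [u [u_mono uE u_lift]]] := equalizer_ex C_lim (d1 ∘ wc ∘ u1) (d1 ∘ ud).
have U_lift (S : C) (x : hom S W) (y : hom S D) :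
    d0 ∘ (va ∘ (w ∘ x)) = d0 ∘ y -> d1 ∘ (wc ∘ x) = d1 ∘ y ->
    exists h : hom S U, u1 ∘ (u ∘ h) = x.
  move=> e0 e1; have [|h [h1 h2]] := pullback_lift (a := x) (b := y) uP.
    by rewrite -!composeA.
  have [|h' h'P] := u_lift _ h; first by rewrite -!composeA h1 h2.
  by exists h'; rewrite h'P h1.
have m_mono : mono (u1 ∘ u).
  move=> S x y; rewrite -!composeA => exy; apply: u_mono.
  apply: (pullback_mono uP) => //; apply: d_mono.
    by rewrite !(composeA d0) -uP.1 -!composeA exy.
  by rewrite !(composeA d1) !(composeA _ u) -uE -!composeA exy.
have [|s [sw sc]] := pullback_lift (a := idm V) (b := vb) wP; first by rewrite composem1.
have [||s' s'P] := U_lift V s va; first by rewrite sw composem1.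
  by rewrite sc -vP.1.
have [K [k kP]] := kernel_ex C_lim C_ptd w.
have wk0 := kP.1.
have [|//|k' k'P] := U_lift K k (wc ∘ k).
  rewrite !composeA -wP.1 -!composeA.
  by apply: zero_mor_uniq; do 2![apply: zero_mor_compl].
have m_iso : is_iso (u1 ∘ u).
  apply: (section_kernel_cover (p := w) (s := s) (k := k) (s' := s') (k' := k')) => //.
    by rewrite -composeA.
  by rewrite -composeA.
have [m' [_ mm']] := m_iso.
have [v [v1 v2]] := pullback_lift vP ab.
have [|x [x1 x2]] := pullback_lift (a := v) (b := c) wP; first by rewrite -composeA v2.
have x_eq : u1 ∘ (u ∘ (m' ∘ x)) = x by rewrite !composeA mm' compose1m.
exists (ud ∘ (u ∘ (m' ∘ x))); split.
  by rewrite composeA -uP.1 -!composeA x_eq x1 v1.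
by rewrite !composeA -uE -!composeA x_eq x2.
Qed.

Lemma reflexive_relation_equivalence (X R : C) (r1 r2 : hom R X) (d : hom X R) :
  (forall (T : C) (a b : hom T R), r1 ∘ a = r1 ∘ b -> r2 ∘ a = r2 ∘ b -> a = b) ->
  r1 ∘ d = idm X -> r2 ∘ d = idm X -> equivalence_relation r1 r2.
Proof.
move=> r_mono d1 d2; have difun := relation_difunctional r_mono.
split=> // [T a|T a b [h [<- <-]]|T a b c [h [<- hb]] [h' [h'b <-]]].
- by exists (d ∘ a); rewrite (compose_eq d1) (compose_eq d2) compose1m.
- have [||g [g1 g2]] := difun T (d ∘ (r2 ∘ h)) h (d ∘ (r1 ∘ h)).
  + by rewrite (compose_eq d2) compose1m.
  + by rewrite (compose_eq d1) compose1m.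
  by exists g; rewrite g1 g2 (compose_eq d1) (compose_eq d2) !compose1m.
- have [||g [g1 g2]] := difun T h (d ∘ b) h'.
  + by rewrite (compose_eq d2) compose1m.
  + by rewrite (compose_eq d1) compose1m.
  by exists g.
Qed.

(** With subtraction, an element [r'] of the kernel of [p'] lifted to [r] would be
    the image of [r - s (p r)].  Difunctionality replaces subtraction: in the
    relation of pairs [(p r, al r)] one has [(0, 0)], [(p r, 0)] (the image of
    [s (p r)]) and [(p r, r')], hence [(0, r')]. *)
Lemma split_epi_kernel_regular_epi (R X R' X' K K' : C)
  (p : hom R X) (s : hom X R) (p' : hom R' X') (s' : hom X' R')
  (al : hom R R') (be : hom X X') (k : hom K R) (k' : hom K' R') (a : hom K K') :
  p ∘ s = idm X -> p' ∘ al = be ∘ p -> al ∘ s = s' ∘ be -> regular_epi al ->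
  is_kernel k p -> is_kernel k' p' -> k' ∘ a = al ∘ k -> regular_epi a.
Proof.
move=> ps sq_p sq_s al_reg kP k'P ka.
have [T0 [x [y TP]]] := pullback_ex C_lim be p'.
have [c [c1 c2]] := pullback_lift TP (esym sq_p).
have [D [e [m [e_reg m_mono me]]]] := image_ex C_reg c.
have D_mono (T : C) (u v : hom T D) :
    x ∘ m ∘ u = x ∘ m ∘ v -> y ∘ m ∘ u = y ∘ m ∘ v -> u = v.
  by rewrite -!composeA => eux euy; apply: m_mono; exact: (pullback_mono TP).
have [T1 [t [r [t_reg rP]]]] := regular_epi_cover C_reg k' al_reg.
have pr0 : zero_mor (be ∘ (p ∘ r)).
  by rewrite composeA -sq_p -composeA rP; exact: kernel_zero k'P.
have [o o0] := zero_mor_ex C_ptd T1 D.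
have xme : x ∘ m ∘ e = p by rewrite -composeA me.
have yme : y ∘ m ∘ e = al by rewrite -composeA me.
(* The relation is the image [D] of [(p, al)], inside the pullback [T0]. *)
have [||d [d1 d2]] := relation_difunctional D_mono
    (a := o) (b := e ∘ (s ∘ (p ∘ r))) (c := e ∘ r).
- rewrite (compose_eq yme) (compose_eq sq_s) -(composeA s').
  by apply: zero_mor_uniq; exact: zero_mor_compl.
- by rewrite !(compose_eq xme) (compose_eq ps) compose1m.
have [T2 [t' [r0 [t'_reg r0P]]]] := regular_epi_cover C_reg d e_reg.
have [|k0 k0P] := kernel_lift (a := r0) kP.
  rewrite -xme -composeA r0P (compose_eq d1).
  by apply: zero_mor_compr; exact: zero_mor_compl.
apply: (@regular_epi_of_comp _ C_reg _ _ _ _ k0).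
suff -> : a ∘ k0 = t ∘ t' by exact: regular_epi_comp.
apply: (kernel_mono k'P).
rewrite (compose_eq ka) -composeA k0P -yme -composeA r0P (compose_eq d2).
by rewrite (compose_eq yme) rP composeA.
Qed.

End Homological.

(** * Normal extensions *)

Section NormalExtensions.
Variables (A X : category) (L : functor A X) (J : functor X A).
Variable adj : adjunction L J.
Local Notation eta := (adj_unit adj).

Hypotheses (A_ptd : pointed A) (A_exact : barr_exact A) (A_proto : protomodular A).

Let A_reg : regular_category A. Proof. by case: A_exact. Qed.
Let A_lim : finitely_complete A. Proof. by case: A_reg. Qed.

Lemma unit_zero_map (Y Z T : A) (f : hom Y Z) (y : hom T Y) :
  zero_mor (eta Y ∘ y) -> zero_mor (eta Z ∘ (f ∘ y)).
Proof.
by move=> y0; rewrite composeA -adj_unit_nat -composeA; exact: zero_mor_compl.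
Qed.

Lemma unit_zero_factor (Y T : A) (Z : X) (g : hom Y (J Z)) (y : hom T Y) :
  zero_mor (eta Y ∘ y) -> zero_mor (g ∘ y).
Proof.
move=> y0; have [h [<- _]] := adj_unit_univ adj g.
by rewrite -composeA; exact: zero_mor_compl.
Qed.

(** Preservation of the kernels of split epimorphisms, weakened by allowing a
    regular quotient.  The theory of normal extensions below needs nothing more of
    the reflection. *)
Definition unit_covers_split_kernels : Prop :=
  forall (R E K K' : A) (p : hom R E) (s : hom E R) (k : hom K R)
    (k' : hom K' (J (L R))) (a : hom K K'),
  p ∘ s = idm E -> is_kernel k p -> is_kernel k' (fmap J (fmap L p)) ->
  k' ∘ a = eta R ∘ k -> regular_epi a.

Lemma normal_extension_unit_mono (E B R : A) (p : hom E B) (r1 r2 : hom R E) :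
  normal_extension adj p -> is_kernel_pair p r1 r2 ->
  forall (T : A) (z w : hom T R),
  r1 ∘ z = r1 ∘ w -> eta R ∘ z = eta R ∘ w -> z = w.
Proof.
by move=> [_ p_norm] rP T z w; have [_ sq] := p_norm _ _ _ rP; exact: (pullback_mono sq).
Qed.

(** The comparison from the kernel pair [R] to the pullback of [G r1] along [eta E]
    is a morphism of split epimorphisms over [E].  On kernels it is a regular
    epimorphism by [unit_covers_split_kernels] and a monomorphism by hypothesis. *)
Lemma normal_extension_of_kernel (E B : A) (p : hom E B) :
  unit_covers_split_kernels -> regular_epi p ->
  (forall (R : A) (r1 r2 : hom R E), is_kernel_pair p r1 r2 ->
    forall (T : A) (z : hom T R),
    zero_mor (r1 ∘ z) -> zero_mor (eta R ∘ z) -> zero_mor z) ->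
  normal_extension adj p.
Proof.
move=> covers p_reg p_ker; split=> // R r1 r2 rP.
have [d [d1 d2]] := kernel_pair_diagonal rP.
split; first exact: split_epi_regular d1.
have [K [k kP]] := kernel_ex A_lim A_ptd r1.
have [K' [k' k'P]] := kernel_ex A_lim A_ptd (fmap J (fmap L r1)).
have [|a ka] := kernel_lift (a := eta R ∘ k) k'P.
  by rewrite composeA adj_unit_nat -composeA; exact: zero_mor_compl kP.1.
have a_iso : is_iso a.
  apply: regular_epi_mono_iso; first exact: (covers _ _ _ _ _ _ _ _ _ d1 kP k'P ka).
  apply: mono_of_zero_kernel => // T y ay0.
  apply: (mono_zero A_ptd (kernel_mono kP)); apply: (p_ker _ _ _ rP).
    exact: kernel_zero kP.
  by rewrite (compose_eq (esym ka)) -composeA; exact: zero_mor_compl.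
have [Q [b1 [b2 QP]]] := pullback_ex A_lim (eta E) (fmap J (fmap L r1)).
have sq : eta E ∘ r1 = fmap J (fmap L r1) ∘ eta R by rewrite adj_unit_nat.
have [h [h1 h2]] := pullback_lift QP sq.
have [o o0] := zero_mor_ex A_ptd K' E.
have [|l [l1 l2]] := pullback_lift (a := o) (b := k') QP.
  by apply: zero_mor_uniq; [exact: zero_mor_compl | exact: k'P.1].
have lP : is_kernel l b1.
  apply: kernelI => [||T y b1y0]; first by rewrite l1.
    by apply: (@mono_of_comp _ _ _ _ b2); rewrite l2; exact: kernel_mono k'P.
  have [|x xP] := kernel_lift (a := b2 ∘ y) k'P.
    by rewrite composeA -QP.1 -composeA; exact: zero_mor_compl.
  exists x; apply: (pullback_mono QP); last by rewrite (compose_eq l2).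
  by apply: zero_mor_uniq; rewrite // composeA l1; exact: zero_mor_compr.
have [g [gh hg]] : is_iso h.
  apply: (split_short_five A_ptd A_proto (s := d) (t := h ∘ d) (k := k) (l := l)
    (a := a) d1 _ h1) => //; first by rewrite (compose_eq h1).
  apply: (pullback_mono QP); last by rewrite (compose_eq l2) (compose_eq h2).
  rewrite (compose_eq h1) (compose_eq l1).
  by apply: zero_mor_uniq; [exact: zero_mor_compr | exact: kP.1].
apply: pullbackI => // [T x y xy1 xy2|T x y xy].
  by apply: (iso_mono (ex_intro _ g (conj gh hg))); apply: (pullback_mono QP);
     rewrite ?(compose_eq h1) ?(compose_eq h2).
have [w [w1 w2]] := pullback_lift QP xy.
exists (g ∘ w); split.
  by rewrite -h1 -composeA (compose_eq hg) compose1m.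
by rewrite -h2 -composeA (compose_eq hg) compose1m.
Qed.

(** Whether [eta] kills a pair does not depend on the chosen kernel pair. *)
Lemma kernel_pair_unit_zero (P B R R' T : A) (f : hom P B) (r1 r2 : hom R P)
  (r1' r2' : hom R' P) (z : hom T R) (z' : hom T R') :
  is_kernel_pair f r1 r2 -> is_kernel_pair f r1' r2' ->
  r1 ∘ z = r1' ∘ z' -> r2 ∘ z = r2' ∘ z' ->
  zero_mor (eta R ∘ z) -> zero_mor (eta R' ∘ z').
Proof.
move=> rP r'P z1 z2; have [c [c1 c2]] := pullback_lift r'P rP.1.
suff -> : z' = c ∘ z by exact: unit_zero_map.
by apply: (pullback_mono r'P); rewrite ?(compose_eq c1) ?(compose_eq c2).
Qed.

(** The reflection of [f] among normal extensions of [B].  The clause on kernels says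
    that [q] kills [y] exactly when [eta] kills the pair [(0, y)]. *)
Lemma normal_extension_reflection (P B : A) (f : hom P B) :
  unit_covers_split_kernels -> regular_epi f ->
  exists (E : A) (q : hom P E) (p : hom E B),
  [/\ regular_epi q, p ∘ q = f, normal_extension adj p,
      forall (R : A) (r1 r2 : hom R P), is_kernel_pair f r1 r2 ->
        forall (T : A) (z : hom T R), zero_mor (r1 ∘ z) ->
        (zero_mor (q ∘ (r2 ∘ z)) <-> zero_mor (eta R ∘ z)) &
      forall (E' : A) (p' : hom E' B) (h : hom P E'),
        normal_extension adj p' -> p' ∘ h = f ->
        exists u : hom E E', u ∘ q = h /\ p' ∘ u = p].
Proof.
move=> covers f_reg; have [R [r1 [r2 rP]]] := kernel_pair_ex A_lim f.
have [d [d1 d2]] := kernel_pair_diagonal rP.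
(* [S] is the relation of pairs [(x, y)] with [eta (x, y) = eta (x, x)]. *)
have [S [m [m_mono mE m_lift]]] := equalizer_ex A_lim (eta R) (eta R ∘ (d ∘ r1)).
have [d' d'P] : exists d', m ∘ d' = d.
  by apply: m_lift; rewrite -!composeA d1 composem1.
have S_equiv : equivalence_relation (r1 ∘ m) (r2 ∘ m).
  apply: (reflexive_relation_equivalence A_ptd A_reg A_proto (d := d')).
  - move=> T a b; rewrite -!composeA => ab1 ab2.
    by apply: m_mono; exact: (pullback_mono rP).
  - by rewrite -composeA d'P.
  - by rewrite -composeA d'P.
have [Y [g gP]] : exists (Y : A) (g : hom P Y), is_kernel_pair g (r1 ∘ m) (r2 ∘ m).
  by case: A_exact => _; apply.
have [E [q qP]] : exists (E : A) (q : hom P E), is_coequalizer (r1 ∘ m) (r2 ∘ m) q.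
  by case: A_reg => _ + _; apply; eassumption.
have q_reg : regular_epi q by exists S, (r1 ∘ m), (r2 ∘ m).
have q_rel (T : A) (z : hom T R) :
    q ∘ (r1 ∘ z) = q ∘ (r2 ∘ z) -> eta R ∘ z = eta R ∘ (d ∘ (r1 ∘ z)).
  have [g' [g'P _]] := qP.2 _ _ gP.1.
  move=> qz; have [|s [s1 s2]] := pullback_lift (a := r1 ∘ z) (b := r2 ∘ z) gP.
    by rewrite -g'P -!composeA qz.
  suff -> : z = m ∘ s by rewrite !composeA mE !composeA.
  by apply: (pullback_mono rP); rewrite composeA ?s1 ?s2.
have rel_q (T : A) (z : hom T R) :
    eta R ∘ z = eta R ∘ (d ∘ (r1 ∘ z)) -> q ∘ (r1 ∘ z) = q ∘ (r2 ∘ z).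
  move=> ez; have [|s <-] := m_lift _ z; first by rewrite -!composeA.
  by rewrite (composeA r1) (composeA r2) (compose_eq qP.1) -composeA.
have q_ker (T : A) (z : hom T R) : zero_mor (r1 ∘ z) ->
    zero_mor (q ∘ (r2 ∘ z)) <-> zero_mor (eta R ∘ z).
  move=> z0; split=> [qz0|ez0].
    rewrite q_rel; first by do 2![apply: zero_mor_compl].
    by apply: zero_mor_uniq; rewrite //; exact: zero_mor_compl.
  rewrite -rel_q; first exact: zero_mor_compl.
  by apply: zero_mor_uniq; rewrite //; do 2![apply: zero_mor_compl].
have [p [pq _]] : exists! p, p ∘ q = f.
  by apply: qP.2; rewrite !composeA rP.1.
have p_reg : regular_epi p by apply: (@regular_epi_of_comp _ A_reg _ _ _ _ q); rewrite pq.
exists E, q, p; split=> //.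
- apply: normal_extension_of_kernel => // R' r1' r2' r'P T w w1 ew.
  have [|rho [rho1 rho2]] := pullback_lift (a := q ∘ r1) (b := q ∘ r2) r'P.
    by rewrite !(compose_eq pq) rP.1.
  have rho_reg : regular_epi rho.
    have [T1 [t1 [a [t1_reg aP]]]] := regular_epi_cover A_reg r1' q_reg.
    have [T2 [t2 [b [t2_reg bP]]]] := regular_epi_cover A_reg (r2' ∘ t1) q_reg.
    have [|z [z1 z2]] := pullback_lift (a := a ∘ t2) (b := b) rP.
      by rewrite -pq -!composeA bP (compose_eq aP) -!composeA (compose_eq r'P.1)
                 -composeA.
    apply: (@regular_epi_of_comp _ A_reg _ _ _ _ z).
    suff -> : rho ∘ z = t1 ∘ t2 by exact: regular_epi_comp.
    apply: (pullback_mono r'P).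
      by rewrite (compose_eq rho1) -composeA z1 (compose_eq aP) -composeA.
    by rewrite (compose_eq rho2) -composeA z2 bP -composeA.
  (* If [q x = q y = 0], then [(x, y)] lies in [S], hence
     [eta (x, y) = eta (x, x)]; and the unit kills [x] because it kills [(0, x)].
     So [eta R] vanishes on the kernel of [rho]. *)
  have [c cP] : exists c, c ∘ rho = eta R.
    apply: (regular_epi_factor A_ptd A_reg A_proto rho_reg) => W z z0.
    have qz1 : zero_mor (q ∘ (r1 ∘ z)).
      by rewrite composeA -rho1 -composeA; exact: zero_mor_compl.
    have qz2 : zero_mor (q ∘ (r2 ∘ z)).
      by rewrite composeA -rho2 -composeA; exact: zero_mor_compl.
    rewrite q_rel; last exact: zero_mor_uniq.
    apply: unit_zero_map.
    have [o o0] := zero_mor_ex A_ptd W P.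
    have [|x [x1 x2]] := pullback_lift (a := o) (b := r1 ∘ z) rP.
      rewrite -pq -!composeA; apply: zero_mor_uniq; last exact: zero_mor_compl.
      by do 2![apply: zero_mor_compl].
    rewrite -x2; apply: unit_zero_map; apply/q_ker; first by rewrite x1.
    by rewrite x2.
  (* The element [w = (0, y)] lifts to a pair [(0, b)], and not merely to
     some pair, because its first component is zero. *)
  have [o o0] := zero_mor_ex A_ptd T P.
  have [T1 [t [b [t_reg bP]]]] := regular_epi_cover A_reg (r2' ∘ w) q_reg.
  have [|z [z1 z2]] := pullback_lift (a := o ∘ t) (b := b) rP.
    rewrite -pq -!composeA bP -composeA (compose_eq (esym r'P.1)) -composeA.
    apply: zero_mor_uniq; first by do 2![apply: zero_mor_compl]; exact: zero_mor_compr.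
    by apply: zero_mor_compl; rewrite composeA; exact: zero_mor_compr.
  have oz : zero_mor (o ∘ t) by exact: zero_mor_compr.
  have zw : rho ∘ z = w ∘ t.
    apply: (pullback_mono r'P).
      rewrite (compose_eq rho1) -composeA z1; apply: zero_mor_uniq.
        exact: zero_mor_compl.
      by rewrite composeA; exact: zero_mor_compr.
    by rewrite (compose_eq rho2) -composeA z2 bP composeA.
  have z0 : zero_mor (eta R ∘ z).
    rewrite -cP -composeA zw composeA; apply: zero_mor_compr.
    exact: unit_zero_factor.
  apply: (epi_zero A_ptd t_reg); rewrite -zw.
  have [o' o'0] := zero_mor_ex A_ptd T1 R'.
  suff -> : rho ∘ z = o' by [].
  apply: (pullback_mono r'P); apply: zero_mor_uniq; do ?exact: zero_mor_compl.
    by rewrite (compose_eq rho1) -composeA z1; exact: zero_mor_compl.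
  rewrite (compose_eq rho2) -composeA; apply/q_ker => //; by rewrite z1.
- move=> R' r1' r2' r'P T z z0.
  have [z' [z'1 z'2]] : exists z', r1 ∘ z' = r1' ∘ z /\ r2 ∘ z' = r2' ∘ z.
    by apply: (pullback_lift rP); rewrite !composeA r'P.1.
  rewrite -z'2; split=> [|ez].
    move/q_ker; rewrite z'1 => /(_ z0).
    exact: (kernel_pair_unit_zero rP r'P).
  apply/q_ker; first by rewrite z'1.
  by apply: (kernel_pair_unit_zero r'P rP _ _ ez).
- move=> E' p' h p'_norm p'h.
  have [R' [r1' [r2' r'P]]] := kernel_pair_ex A_lim p'.
  have [d0 [d01 d02]] := kernel_pair_diagonal r'P.
  have [|rho [rho1 rho2]] := pullback_lift (a := h ∘ r1) (b := h ∘ r2) r'P.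
    by rewrite !(compose_eq p'h) rP.1.
  have rho_d : rho ∘ (d ∘ (r1 ∘ m)) = d0 ∘ (h ∘ (r1 ∘ m)).
    apply: (pullback_mono r'P).
      by rewrite (compose_eq rho1) (compose_eq d01) -composeA (compose_eq d1) !compose1m.
    by rewrite (compose_eq rho2) (compose_eq d02) -composeA (compose_eq d2) !compose1m.
  have rho_m : rho ∘ m = d0 ∘ (h ∘ (r1 ∘ m)).
    apply: (normal_extension_unit_mono p'_norm r'P).
      by rewrite (compose_eq rho1) (compose_eq d01) compose1m -composeA.
    by rewrite -rho_d !composeA -adj_unit_nat -!(composeA _ (eta R)) mE -!composeA.
  have [|u [uq _]] := qP.2 _ h.
    by rewrite !composeA -rho1 -rho2 -!composeA rho_m (compose_eq d01) (compose_eq d02).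
  exists u; split=> //; apply: (regular_epi_epi q_reg).
  by rewrite -composeA uq p'h.
Qed.

End NormalExtensions.

(** * Galois groups *)

(** The meet of the kernels of [f] and [g], as a subobject of [E]. *)
Definition joint_kernel (C : category) (M E B D : C) (i : hom M E)
  (f : hom E B) (g : hom E D) : Prop :=
  [/\ zero_mor (f ∘ i), zero_mor (g ∘ i), mono i &
    forall (T : C) (a : hom T E), zero_mor (f ∘ a) -> zero_mor (g ∘ a) ->
    exists h : hom T M, i ∘ h = a].

Lemma joint_kernel_ex (C : category) (E B D : C) (f : hom E B) (g : hom E D) :
  finitely_complete C -> pointed C ->
  exists (M : C) (i : hom M E), joint_kernel i f g.
Proof.
move=> C_lim C_ptd; have [K [k kP]] := kernel_ex C_lim C_ptd f.
have [M [m mP]] := kernel_ex C_lim C_ptd (g ∘ k).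
exists M, (k ∘ m); split.
- exact: kernel_zero kP.
- by rewrite composeA; exact: mP.1.
- by apply: mono_comp; [exact: kernel_mono kP | exact: kernel_mono mP].
move=> T a /(kernel_lift kP)[b <-]; rewrite composeA => /(kernel_lift mP)[h hP].
by exists h; rewrite -composeA hP.
Qed.

Section GaloisGroup.
Variables (A X : category) (L : functor A X) (J : functor X A).
Variable adj : adjunction L J.
Local Notation eta := (adj_unit adj).

Hypotheses (A_ptd : pointed A) (A_lim : finitely_complete A) (X_ptd : pointed X).

Lemma unit_cancel (Y : A) (Z : X) (g h : hom (L Y) Z) :
  fmap J g ∘ eta Y = fmap J h ∘ eta Y -> g = h.
Proof.
move=> gh; have [k [_ k_uniq]] := adj_unit_univ adj (fmap J h ∘ eta Y).
by rewrite -(k_uniq h) // (k_uniq g).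
Qed.

Lemma right_adjoint_mono (Y Z : X) (m : hom Y Z) : mono m -> mono (fmap J m).
Proof.
move=> m_mono T a b; have [a' [<- _]] := adj_unit_univ adj a.
have [b' [<- _]] := adj_unit_univ adj b.
by rewrite !composeA -!fmap_comp => /unit_cancel/m_mono ->.
Qed.

Lemma right_adjoint_zero (Y Z : X) (f : hom Y Z) : zero_mor f -> zero_mor (fmap J f).
Proof.
move=> [O [O0 [u [v ->]]]]; rewrite fmap_comp; apply: zero_mor_compl.
have [z z0] := zero_mor_ex A_ptd (J Y) (J O).
suff -> : fmap J u = z by [].
have [u' [<- _]] := adj_unit_univ adj (fmap J u).
have [z' [<- _]] := adj_unit_univ adj z.
by rewrite (terminal_uniq u' z' O0).
Qed.

Lemma unit_zero_transpose (Y : A) (Z : X) (g : hom (L Y) Z) :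
  zero_mor (fmap J g ∘ eta Y) -> zero_mor g.
Proof.
move=> g0; have [z z0] := zero_mor_ex X_ptd (L Y) Z.
suff -> : g = z by [].
apply: unit_cancel; apply: zero_mor_uniq => //.
by apply: zero_mor_compr; exact: right_adjoint_zero.
Qed.

Lemma unit_zero_fmap (Y Z : A) (f : hom Y Z) :
  zero_mor (eta Z ∘ f) -> zero_mor (fmap L f).
Proof. by move=> f0; apply: unit_zero_transpose; rewrite adj_unit_nat. Qed.

Lemma right_adjoint_kernel (K Y Z : X) (k : hom K Y) (f : hom Y Z) :
  is_kernel k f -> is_kernel (fmap J k) (fmap J f).
Proof.
move=> kP; apply: kernelI => [||T a].
- by rewrite -fmap_comp; apply: right_adjoint_zero; exact: kP.1.
- by apply: right_adjoint_mono; exact: kernel_mono kP.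
have [a' [<- _]] := adj_unit_univ adj a.
rewrite composeA -fmap_comp => /unit_zero_transpose/(kernel_lift kP)[h <-].
by exists (fmap J h ∘ eta T); rewrite composeA -fmap_comp.
Qed.

(** An element of the kernel of [<G r1, G r2>] is, by the pullback square of the
    normal extension, a pair [(0, y)] in [R], and [G r2] sends it to [eta E ∘ y]. *)
Lemma galois_group_joint_kernel (E B : A) (p : hom E B) (G : X) :
  normal_extension adj p -> is_galois_group L p G ->
  exists i : hom (J G) E, joint_kernel i p (eta E).
Proof.
move=> p_norm [R [r1 [r2 [Q [q1 [q2 [m [k [rP QP m1 m2 kP]]]]]]]]].
have [_ R_pb] := p_norm.2 _ _ _ rP.
have Jk_mono := right_adjoint_mono (kernel_mono kP).
have Jk_zero (r : hom R E) (qr : hom Q (L E)) :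
    qr ∘ m = fmap L r -> zero_mor (fmap J (fmap L r) ∘ fmap J k).
  move=> <-; rewrite -fmap_comp -composeA; apply: right_adjoint_zero.
  by apply: zero_mor_compl; exact: kP.1.
have [o o0] := zero_mor_ex A_ptd (J G) E.
have [|h [h1 h2]] := pullback_lift (a := o) (b := fmap J k) R_pb.
  by apply: zero_mor_uniq; [exact: zero_mor_compl | exact: Jk_zero m1].
have eta_z (T : A) (z : hom T R) : zero_mor (r1 ∘ z) -> zero_mor (eta E ∘ (r2 ∘ z)) ->
    exists x, h ∘ x = z.
  move=> z1 z2.
  have Lz1 : zero_mor (fmap L (r1 ∘ z)).
    by apply: unit_zero_fmap; exact: zero_mor_compl.
  have Lz2 := unit_zero_fmap z2.
  have [|y yP] := kernel_lift (a := fmap L z) kP.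
    have [w w0] := zero_mor_ex X_ptd (L T) Q.
    suff -> : m ∘ fmap L z = w by [].
    have [c [_ c_uniq]] := QP _ (q1 ∘ w) (q2 ∘ w).
    rewrite -(c_uniq w) // -(c_uniq (m ∘ fmap L z)) // !composeA m1 m2 -!fmap_comp.
    by split; apply: zero_mor_uniq => //; exact: zero_mor_compl.
  exists (fmap J y ∘ eta T); apply: (pullback_mono R_pb).
    apply: zero_mor_uniq; last exact: z1.
    by rewrite (compose_eq h1); exact: zero_mor_compr.
  by rewrite (compose_eq h2) composeA -fmap_comp yP adj_unit_nat.
exists (r2 ∘ h); split.
- rewrite composeA -rP.1 -composeA h1; exact: zero_mor_compl.
- by rewrite composeA -adj_unit_nat -composeA h2; exact: Jk_zero m2.
- move=> T a b; rewrite -!composeA => ab; apply: Jk_mono.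
  rewrite -h2 -!composeA; congr (_ ∘ _); apply: (pullback_mono rP) => //.
  by rewrite !(compose_eq h1); apply: zero_mor_uniq; exact: zero_mor_compr.
move=> T a pa ea; have [o' o'0] := zero_mor_ex A_ptd T E.
have [|z [z1 z2]] := pullback_lift (a := o') (b := a) rP.
  by apply: zero_mor_uniq => //; exact: zero_mor_compl.
have [||x xP] := eta_z T z; rewrite ?z1 ?z2 //.
by exists x; rewrite -composeA xP.
Qed.

(** The pair [(u y, v y)] and the diagonal pair [(u y, u y)] have the same first
    component and both are killed by the unit, so they coincide. *)
Lemma normal_extension_maps_agree (E E' B T : A) (p : hom E B) (p' : hom E' B)
  (u v : hom E E') (y : hom T E) :
  normal_extension adj p' -> p' ∘ u = p -> p' ∘ v = p ->
  zero_mor (eta E ∘ y) -> u ∘ y = v ∘ y.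
Proof.
move=> p'_norm pu pv ey.
have [R [r1 [r2 rP]]] := kernel_pair_ex A_lim p'.
have [d [d1 d2]] := kernel_pair_diagonal rP.
have [|w [w1 w2]] := pullback_lift (a := u) (b := v) rP; first by rewrite pu pv.
have wd : w ∘ y = d ∘ (u ∘ y).
  apply: (normal_extension_unit_mono p'_norm rP).
    by rewrite (compose_eq w1) (compose_eq d1) compose1m.
  by apply: zero_mor_uniq; do ?apply: unit_zero_map.
by rewrite -w2 -composeA wd (compose_eq d2) compose1m.
Qed.

Lemma joint_kernel_isomorphic (E E' B M M' : A) (p : hom E B) (p' : hom E' B)
  (i : hom M E) (i' : hom M' E') :
  weakly_universal_normal_extension adj p -> weakly_universal_normal_extension adj p' ->
  joint_kernel i p (eta E) -> joint_kernel i' p' (eta E') -> isomorphic M M'.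
Proof.
move=> [p_norm p_univ] [p'_norm p'_univ].
move=> [pi0 ei0 i_mono i_lift] [p'i0 e'i0 i'_mono i'_lift].
have [u pu] := p_univ _ _ p'_norm; have [v pv] := p'_univ _ _ p_norm.
have [||x xP] := i'_lift _ (u ∘ i); first by rewrite (compose_eq (esym pu)).
  exact: unit_zero_map.
have [||y yP] := i_lift _ (v ∘ i'); first by rewrite (compose_eq (esym pv)).
  exact: unit_zero_map.
exists x, y; split; [apply: i_mono | apply: i'_mono]; rewrite composem1.
- rewrite (compose_eq yP) -composeA xP composeA -[RHS]compose1m.
  apply: (normal_extension_maps_agree (p := p) p_norm _ _ ei0); last by rewrite composem1.
  by rewrite (compose_eq (esym pv)).
- rewrite (compose_eq xP) -composeA yP composeA -[RHS]compose1m.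
  apply: (normal_extension_maps_agree (p := p') p'_norm _ _ e'i0); last by rewrite composem1.
  by rewrite (compose_eq (esym pu)).
Qed.

Hypothesis J_ff : forall (Y Z : X) (g : hom (J Y) (J Z)), exists! h, fmap J h = g.
Hypothesis eta_reg : forall Y : A, regular_epi (eta Y).

Lemma right_adjoint_faithful (Y Z : X) (g h : hom Y Z) : fmap J g = fmap J h -> g = h.
Proof.
by move=> gh; have [k [_ k_uniq]] := J_ff (fmap J h); rewrite -(k_uniq g) // (k_uniq h).
Qed.

(** The unit at the product [M] computed in [A] is a monomorphism, because both
    projections factor through it, hence an isomorphism. *)
Lemma reflective_product_ex (Y Z : X) :
  exists (Q : X) (q1 : hom Q Y) (q2 : hom Q Z), is_product q1 q2.
Proof.
have [M [p1 [p2 MP]]] := product_ex A_lim (J Y) (J Z).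
have [q1 [q1P _]] := adj_unit_univ adj p1; have [q2 [q2P _]] := adj_unit_univ adj p2.
have M_mono (T : A) (a b : hom T M) : p1 ∘ a = p1 ∘ b -> p2 ∘ a = p2 ∘ b -> a = b.
  move=> e1 e2; have [h [_ h_uniq]] := MP _ (p1 ∘ a) (p2 ∘ a).
  by rewrite -(h_uniq a) // -(h_uniq b).
have [e [e1 e2]] : is_iso (eta M).
  apply: regular_epi_mono_iso => // => T a b ab.
  by apply: M_mono; rewrite -?q1P -?q2P -!composeA ab.
exists (L M), q1, q2 => T a b; have [h [[h1 h2] h_uniq]] := MP _ (fmap J a) (fmap J b).
have [h' [h'P _]] := J_ff (eta M ∘ h).
exists h'; split.
  by split; apply: right_adjoint_faithful; rewrite fmap_comp h'P composeA ?q1P ?q2P.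
move=> g [g1 g2]; apply: right_adjoint_faithful; rewrite h'P (h_uniq (e ∘ fmap J g)).
  by rewrite composeA e2 compose1m.
by split; rewrite -?q1P -?q2P -composeA (compose_eq e2) compose1m -fmap_comp ?g1 ?g2.
Qed.

(** As for products: the kernel computed in [A] embeds in an object of the
    subcategory, so that its unit is a monomorphism. *)
Lemma reflective_kernel_ex (Y Z : X) (f : hom Y Z) :
  exists (K : X) (k : hom K Y), is_kernel k f.
Proof.
have [M [m mP]] := kernel_ex A_lim A_ptd (fmap J f).
have [k [kP _]] := adj_unit_univ adj m.
have [e [e1 e2]] : is_iso (eta M).
  apply: regular_epi_mono_iso => //; apply: (@mono_of_comp _ _ _ _ (fmap J k)).
  by rewrite kP; exact: kernel_mono mP.
have me : fmap J k = m ∘ e by rewrite -kP -composeA e2 composem1.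
exists (L M), k; apply: kernelI => [|T a b ab|T a fa0].
- apply: unit_zero_transpose; rewrite fmap_comp -composeA kP; exact: mP.1.
- apply: right_adjoint_faithful; have e_mono : mono e by apply: iso_mono; exists (eta M).
  apply: e_mono; apply: (kernel_mono mP); rewrite !composeA -me.
  by rewrite -!fmap_comp ab.
have [|h hP] := kernel_lift (a := fmap J a) mP.
  by rewrite -fmap_comp; exact: right_adjoint_zero.
have [h' [h'P _]] := J_ff (eta M ∘ h).
exists h'; apply: right_adjoint_faithful.
by rewrite fmap_comp h'P me -composeA (compose_eq e1) compose1m.
Qed.

Lemma galois_group_ex (E B : A) (p : hom E B) :
  exists G : X, is_galois_group L p G.
Proof.
have [R [r1 [r2 rP]]] := kernel_pair_ex A_lim p.
have [Q [q1 [q2 QP]]] := reflective_product_ex (L E) (L E).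
have [m [[m1 m2] _]] := QP _ (fmap L r1) (fmap L r2).
have [G [k kP]] := reflective_kernel_ex m.
by exists G, R, r1, r2, Q, q1, q2, m, k.
Qed.

End GaloisGroup.

(** * Commutators and closures *)

Section Commutators.
Variables (A X : category) (L : functor A X) (J : functor X A).
Variable adj : adjunction L J.
Local Notation eta := (adj_unit adj).

Hypotheses (A_ptd : pointed A) (A_lim : finitely_complete A).

(** A kernel of [h1] consists of the elements of the kernel of the unit at [R] with
    zero first component, that is, of the pairs [(0, y)] killed by the unit. *)
Lemma relative_commutator_kernel (E B K M : A) (f : hom E B) (k : hom K E)
  (m : hom M K) :
  is_kernel k f -> is_relative_commutator adj f (k ∘ m) ->
  exists (R : A) (r1 r2 : hom R E) (kappa : hom K R),
  [/\ is_kernel_pair f r1 r2, r2 ∘ kappa = k, is_kernel kappa r1 &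
      is_kernel m (eta R ∘ kappa)].
Proof.
move=> kP [R [r1 [r2 [KR [KA [kR [kA [h1 [h2 [n [rP [kRP kAP] [kh1 kh2] nP mE]]]]]]]]]]].
have [kappa [kap2 kapP]] := kernel_pair_kernel A_ptd rP kP.
have kap_m : kappa ∘ m = kR ∘ n.
  apply: (pullback_mono rP).
    rewrite (compose_eq (esym kh1)) -composeA; apply: zero_mor_uniq.
      exact: kernel_zero kapP.
    by apply: zero_mor_compl; exact: nP.1.
  by rewrite (compose_eq kap2) mE (compose_eq (esym kh2)).
exists R, r1, r2, kappa; split=> //; apply: kernelI => [||T y].
- by rewrite -composeA kap_m; exact: kernel_zero kRP.
- apply: (@mono_of_comp _ _ _ _ kappa); rewrite kap_m.
  by apply: mono_comp; [exact: kernel_mono kRP | exact: kernel_mono nP].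
rewrite -composeA => /(kernel_lift kRP)[z zP].
have [|x xP] := kernel_lift (a := z) nP.
  apply: (mono_zero A_ptd (kernel_mono kAP)).
  by rewrite (compose_eq kh1) -composeA zP; exact: kernel_zero kapP.
exists x; apply: (kernel_mono kapP).
by rewrite (compose_eq kap_m) -composeA xP.
Qed.

Lemma relative_commutator_of_kernel (E B K M R : A) (f : hom E B) (k : hom K E)
  (m : hom M K) (r1 r2 : hom R E) (kappa : hom K R) :
  is_kernel_pair f r1 r2 -> r2 ∘ kappa = k -> is_kernel kappa r1 ->
  is_kernel m (eta R ∘ kappa) -> is_relative_commutator adj f (k ∘ m).
Proof.
move=> rP kap2 kapP mP.
have [KR [kR kRP]] := kernel_ex A_lim A_ptd (eta R).
have [KA [kA kAP]] := kernel_ex A_lim A_ptd (eta E).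
have [h1 kh1] : exists h, kA ∘ h = r1 ∘ kR.
  by apply: (kernel_lift kAP); apply: unit_zero_map; exact: kRP.1.
have [h2 kh2] : exists h, kA ∘ h = r2 ∘ kR.
  by apply: (kernel_lift kAP); apply: unit_zero_map; exact: kRP.1.
have [|n nE] := kernel_lift (a := kappa ∘ m) kRP.
  by rewrite composeA; exact: mP.1.
exists R, r1, r2, KR, KA, kR, kA, h1, h2, n; split=> //; last first.
  by rewrite kh2 -composeA nE (compose_eq kap2).
apply: kernelI => [||T y hy0].
- apply: (mono_zero A_ptd (kernel_mono kAP)).
  by rewrite (compose_eq kh1) -composeA nE; exact: kernel_zero kapP.
- apply: (@mono_of_comp _ _ _ _ kR); rewrite nE.
  by apply: mono_comp; [exact: kernel_mono kapP | exact: kernel_mono mP].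
have [|x xP] := kernel_lift (a := kR ∘ y) kapP.
  by rewrite (compose_eq (esym kh1)) -composeA; exact: zero_mor_compl.
have [|z zP] := kernel_lift (a := x) mP.
  by rewrite -composeA xP; exact: kernel_zero kRP.
by exists z; apply: (kernel_mono kRP); rewrite (compose_eq nE) -composeA zP.
Qed.

(** Applied to [kappa = (0, 1)] and the second projection, this identifies
    [[E, E]] with the kernel of the unit. *)
Lemma unit_kernel_of_section (E R T : A) (r2 : hom R E) (kappa : hom E R)
  (y : hom T E) :
  r2 ∘ kappa = idm E ->
  zero_mor (eta R ∘ kappa ∘ y) <-> zero_mor (eta E ∘ y).
Proof.
move=> kap2; rewrite -composeA; split=> [|]; last exact: unit_zero_map.
by move/(unit_zero_map r2); rewrite (compose_eq kap2) compose1m.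
Qed.

Lemma zero_codomain_kernel (E Z : A) (f : hom E Z) : is_zero Z -> is_kernel (idm E) f.
Proof.
move=> Z0; apply: kernelI => [|T a b|T a _].
- by rewrite composem1; exists Z; split=> //; exists f, (idm Z); rewrite compose1m.
- by rewrite !compose1m.
by exists a; rewrite compose1m.
Qed.

Lemma absolute_commutator_kernel (E M : A) (m : hom M E) :
  is_absolute_commutator adj m -> is_kernel m (eta E).
Proof.
move=> [Z [f [Z0]]]; rewrite -{1}(compose1m m).
move/(relative_commutator_kernel (zero_codomain_kernel f Z0)).
move=> [R [r1 [r2 [kappa [rP kap2 kapP]]]]].
by apply: kernel_congr => T y; exact: unit_kernel_of_section y kap2.
Qed.

Lemma absolute_commutator_of_kernel (E M : A) (m : hom M E) :
  is_kernel m (eta E) -> is_absolute_commutator adj m.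
Proof.
move=> mP; have [Z Z0] := A_ptd; have [[f _] _] := Z0 E.
have [R [r1 [r2 rP]]] := kernel_pair_ex A_lim f.
have [kappa [kap2 kapP]] := kernel_pair_kernel A_ptd rP (zero_codomain_kernel f Z0).
exists Z, f; split=> //; rewrite -(compose1m m).
apply: (relative_commutator_of_kernel rP kap2 kapP).
apply: (kernel_congr _ mP) => T y; apply: iff_sym.
exact: unit_kernel_of_section y kap2.
Qed.

Lemma closure_kernel (K E K' : A) (k : hom K E) (c : hom K' E) :
  is_closure adj k c ->
  exists (Q : A) (q : hom E Q), short_exact k q /\ is_kernel c (eta Q ∘ q).
Proof.
move=> [Q [q [N [n [r [kq nP cP]]]]]]; exists Q, q; split=> //.
apply: kernelI => [|T a b ab|T a].
- by rewrite -composeA cP.1; exact: kernel_zero nP.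
- apply: (pullback_mono cP) => //; apply: (kernel_mono nP).
  by rewrite !composeA -cP.1 -!composeA ab.
rewrite -composeA => /(kernel_lift nP)[x xP].
by have [h [hP _]] := pullback_lift cP (esym xP); exists h.
Qed.

Lemma closure_ex (K E Q : A) (k : hom K E) (q : hom E Q) :
  short_exact k q -> exists (K' : A) (c : hom K' E), is_closure adj k c.
Proof.
move=> kq; have [N [n nP]] := kernel_ex A_lim A_ptd (eta Q).
have [K' [c [r cP]]] := pullback_ex A_lim q n.
by exists K', c, Q, q, N, n, r.
Qed.

Lemma quotient_unit_zero (M Y Q Q' T : A) (m : hom M Y) (q : hom Y Q) (q' : hom Y Q')
  (y : hom T Y) :
  short_exact m q -> short_exact m q' ->
  zero_mor (eta Q ∘ q ∘ y) -> zero_mor (eta Q' ∘ q' ∘ y).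
Proof.
move=> [_ qP] [_ q'P]; have [i [_ <-]] := cokernel_isomorphic qP q'P.
by rewrite -!composeA; exact: unit_zero_map.
Qed.

End Commutators.

(** * Reflective full subcategories *)

Section FullSubcategory.
Variables (C : category) (S : C -> Prop) (L : functor C (full_sub S)).
Variable adj : adjunction L (incl S).
Hypotheses (C_ptd : pointed C) (adj_reg : forall Y : C, regular_epi (adj_unit adj Y)).

Lemma reflective_pointed : pointed (full_sub S).
Proof.
have [Z Z0] := C_ptd; exists (L Z).
have [i [iu ui]] : is_iso (adj_unit adj Z).
  by apply: regular_epi_mono_iso => // T a b _; exact: terminal_uniq.
have LZ_term (Y : C) (g h : hom Y (incl S (L Z))) : g = h.
  rewrite -(compose1m g) -(compose1m h) -ui -!composeA.
  by rewrite (terminal_uniq (i ∘ g) (i ∘ h)).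
have LZ_init (Y : C) (g h : hom (incl S (L Z)) Y) : g = h.
  rewrite -(composem1 g) -(composem1 h) -ui !composeA.
  by rewrite (initial_uniq (g ∘ _) (h ∘ adj_unit adj Z)).
move=> Y; have [[u _] [v _]] := Z0 (incl S Y); split.
  exists (adj_unit adj Z ∘ u : hom Y (L Z)); split=> // h _; exact: LZ_term.
exists (v ∘ i : hom (L Z) Y); split=> // h _; exact: LZ_init.
Qed.

Lemma sub_zero_mor (Y Z : full_sub S) (f : hom Y Z) :
  zero_mor (fmap (incl S) f) <-> zero_mor f.
Proof.
split=> [f0|]; last exact: (right_adjoint_zero adj).
have [o o0] := zero_mor_ex reflective_pointed Y Z.
suff -> : f = o by [].
by apply: (zero_mor_uniq (C := C)) => //; exact: (right_adjoint_zero adj).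
Qed.

Hypotheses (C_reg : regular_category C) (C_proto : protomodular C).

Lemma sub_split_short_exact (K Y Z : full_sub S) (k : hom K Y) (f : hom Y Z)
  (s : hom Z Y) :
  is_kernel (fmap (incl S) k) (fmap (incl S) f) -> f ∘ s = idm Z ->
  split_short_exact k f s.
Proof.
move=> kP fs; split=> //.
have f_reg : regular_epi (fmap (incl S) f).
  exact: (@split_epi_regular C (incl S Y) (incl S Z) f s fs).
have [_ f_univ] := regular_epi_cokernel C_ptd C_reg C_proto f_reg kP.
split.
  split=> [|T a /sub_zero_mor fa0]; first by apply/sub_zero_mor; exact: kP.1.
  exact: kP.2 fa0.
split=> [|T a /sub_zero_mor ak0]; first by apply/sub_zero_mor; exact: kP.1.
exact: f_univ ak0.
Qed.

(** The image of [f] in [C] lies in the subcategory, which is closed under regular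
    quotients; since [f] is extremal there, it coincides with its image. *)
Lemma sub_regular_epi (Y Z : full_sub S) (f : hom Y Z) :
  (forall (V W : C) (g : hom V W), regular_epi g -> S V -> S W) ->
  regular_epi f -> regular_epi (fmap (incl S) f).
Proof.
move=> S_quot f_reg; have [Q [e [m [e_reg m_mono me]]]] := image_ex C_reg (fmap (incl S) f).
have SQ : S Q by apply: S_quot e_reg _; exact: proj2_sig Y.
pose Q' : full_sub S := exist _ Q SQ.
have m'_mono : @mono (full_sub S) Q' Z m by move=> T a b; exact: m_mono.
have [d [dm md]] := @regular_epi_extremal (full_sub S) Y Z Q' f m e f_reg m'_mono me.
by rewrite -me; apply: iso_comp_regular_epi => //; exists d.
Qed.

End FullSubcategory.

(** * The composite reflection *)

Section HopfFormula.
Variable A : category.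
Hypotheses (A_ptd : pointed A) (A_exact : barr_exact A) (A_proto : protomodular A).
Variables (inB : A -> Prop) (I : functor A (full_sub inB)).
Variable adjI : adjunction I (incl inB).
Hypothesis B_birkhoff : birkhoff adjI.
Variables (inF : full_sub inB -> Prop) (F : functor (full_sub inB) (full_sub inF)).
Variable adjF : adjunction F (incl inF).
Hypotheses (F_reflective : regular_epi_reflective adjF) (F_protoadditive : protoadditive F).

Let A_reg : regular_category A. Proof. by case: A_exact. Qed.
Let A_lim : finitely_complete A. Proof. by case: A_reg. Qed.

Local Notation adj := (comp_adjunction adjI adjF).
Local Notation L := (comp_functor F I).
Local Notation J := (comp_functor (incl inB) (incl inF)).

Let adjI_reg (Y : A) : regular_epi (adj_unit adjI Y).
Proof. by case: B_birkhoff => -[_ +] _; apply. Qed.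

Lemma composite_unit_regular_epi (Y : A) : regular_epi (adj_unit adj Y).
Proof.
apply: (regular_epi_comp A_reg _ (adjI_reg Y)).
apply: (sub_regular_epi A_reg); last by case: F_reflective => _; apply.
by case: B_birkhoff.
Qed.

Let F_pointed : pointed (full_sub inF).
Proof.
apply: (reflective_pointed (adj := adjF)); last by case: F_reflective.
exact: (reflective_pointed A_ptd adjI_reg).
Qed.

(** Here [K0] is the kernel of [I p], and [l] is the kernel of [F (I p)] provided by
    protoadditivity.  The map from [K] to the domain of [l] is [a] followed by the
    unit at [K0]. *)
Lemma split_kernel_cover (R E K : A) (p : hom R E) (s : hom E R) (k : hom K R) :
  p ∘ s = idm E -> is_kernel k p ->
  exists (K0 : A) (a : hom K K0) (k0 : hom K0 (incl inB (I R)))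
    (l : hom (J (L K0)) (J (L R))),
  [/\ regular_epi a, mono k0, k0 ∘ a = adj_unit adjI R ∘ k,
      is_kernel l (fmap J (fmap L p)) &
      l ∘ (adj_unit adj K0 ∘ a) = adj_unit adj R ∘ k].
Proof.
move=> ps kP.
have [K0 [k0 k0P]] := kernel_ex A_lim A_ptd (fmap (incl inB) (fmap I p)).
have k0_mono := kernel_mono k0P.
have Ips : fmap I p ∘ fmap I s = idm (I E) by rewrite -fmap_comp ps fmap_id.
have [|a aE] := kernel_lift (a := adj_unit adjI R ∘ k) k0P.
  by rewrite composeA adj_unit_nat -composeA; exact: zero_mor_compl kP.1.
have a_reg : regular_epi a.
  exact: (split_epi_kernel_regular_epi A_ptd A_reg A_proto ps (adj_unit_nat adjI p)
    (esym (adj_unit_nat adjI s)) (adjI_reg R) kP k0P aE).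
have [k1 [k1E _]] := adj_unit_univ adjI (k0 : hom K0 (incl inB (I R))).
have [e [eu ue]] : is_iso (adj_unit adjI K0).
  apply: regular_epi_mono_iso; first exact: adjI_reg.
  by apply: (@mono_of_comp _ _ _ _ (fmap (incl inB) k1)); rewrite k1E.
have k1e : fmap (incl inB) k1 = k0 ∘ e by rewrite -k1E -composeA ue composem1.
have k1P : is_kernel (fmap (incl inB) k1) (fmap (incl inB) (fmap I p)).
  rewrite k1e; apply: kernelI => [||T y /(kernel_lift k0P)[h hP]].
  - by rewrite composeA; apply: zero_mor_compr; exact: k0P.1.
  - by apply: mono_comp => //; apply: iso_mono; exists (adj_unit adjI K0).
  by exists (adj_unit adjI K0 ∘ h); rewrite -composeA (compose_eq eu) compose1m.
have [[Fk1P _] _] := F_protoadditive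
  (sub_split_short_exact A_ptd adjI_reg A_reg A_proto k1P Ips).
have lP := right_adjoint_kernel adj A_ptd F_pointed Fk1P.
exists K0, a, k0, (fmap J (fmap F k1)); split=> //.
have nat_F : fmap (incl inB) (fmap (incl inF) (fmap F k1)) ∘
    fmap (incl inB) (adj_unit adjF (I K0)) =
    fmap (incl inB) (adj_unit adjF (I R)) ∘ fmap (incl inB) k1.
  by rewrite -!fmap_comp adj_unit_nat.
rewrite /= -!composeA (compose_eq nat_F) -!composeA -aE.
by congr (_ ∘ _); rewrite -(compose_eq k1E).
Qed.

Lemma composite_unit_covers : unit_covers_split_kernels adj.
Proof.
move=> R E K K' p s k k' a ps kP k'P ka.
have [K0 [a0 [k0 [l [a0_reg _ _ lP lE]]]]] := split_kernel_cover ps kP.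
have [i [i_iso k'i]] := kernel_isomorphic lP k'P.
suff -> : a = i ∘ (adj_unit adj K0 ∘ a0).
  apply: iso_comp_regular_epi => //.
  by apply: regular_epi_comp => //; exact: composite_unit_regular_epi.
by apply: (kernel_mono k'P); rewrite ka (compose_eq k'i) lE.
Qed.

(** The quotient of [K] by the commutator is the kernel [K0] of [I p]: [K0] embeds in
    [I R], so that [a] kills exactly what the unit of [I] kills in [R]. *)
Lemma commutator_short_exact (R E K M : A) (p : hom R E) (s : hom E R) (k : hom K R)
  (m : hom M K) :
  p ∘ s = idm E -> is_kernel k p -> is_kernel m (adj_unit adjI R ∘ k) ->
  exists (K0 : A) (a : hom K K0), short_exact m a /\
  forall (T : A) (y : hom T K),
    zero_mor (adj_unit adj K0 ∘ a ∘ y) <-> zero_mor (adj_unit adj R ∘ k ∘ y).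
Proof.
move=> ps kP mP.
have [K0 [a [k0 [l [a_reg k0_mono k0a lP lE]]]]] := split_kernel_cover ps kP.
exists K0, a; split.
  apply: regular_epi_short_exact => //; apply: (kernel_congr _ mP) => T y.
  by rewrite -k0a -composeA; split=> [/(mono_zero A_ptd k0_mono)|/(zero_mor_compl k0)].
move=> T y; rewrite -lE -(composeA l).
by split=> [/(zero_mor_compl l)|/(mono_zero A_ptd (kernel_mono lP))].
Qed.

(** The closure consists of the elements killed by the unit at the quotient [K0] of
    [K]; since [F] preserves the kernel [K0 -> I R], they are those killed by the
    unit at [R]. *)
Lemma commutator_closure_kernel (R E K M C : A) (p : hom R E) (s : hom E R)
  (k : hom K R) (m : hom M K) (c : hom C K) :
  p ∘ s = idm E -> is_kernel k p -> is_kernel m (adj_unit adjI R ∘ k) ->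
  is_closure adj m c -> is_kernel c (adj_unit adj R ∘ k).
Proof.
move=> ps kP mP /closure_kernel[Q [q [mq cP]]].
have [K0 [a [ma a_zero]]] := commutator_short_exact ps kP mP.
apply: (kernel_congr _ cP) => T y; split=> [/(quotient_unit_zero mq ma)/a_zero //|].
by move/a_zero/(quotient_unit_zero ma mq).
Qed.

(** The unit of the composite adjunction at [E] factors through [E / M]. *)
Lemma unit_closure_kernel (E M C : A) (m : hom M E) (c : hom C E) :
  is_kernel m (adj_unit adjI E) -> is_closure adj m c -> is_kernel c (adj_unit adj E).
Proof.
move=> mP /closure_kernel[Q [q [mq cP]]].
apply: (kernel_congr _ cP) => T y; rewrite -composeA; split; last exact: unit_zero_map.
have [g [<- _]] : exists! g, g ∘ q = adj_unit adj E.
  apply: mq.2.2; rewrite /= -composeA; apply: zero_mor_compl; exact: mP.1.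
by rewrite -composeA; exact: unit_zero_factor.
Qed.

(** * The Hopf formula *)

Section Presentation.
Variables (B P E M : A) (f : hom P B) (q : hom P E) (p : hom E B) (i : hom M E).
Hypotheses (q_reg : regular_epi q) (pq : p ∘ q = f).
Hypothesis q_zero : forall (R : A) (r1 r2 : hom R P), is_kernel_pair f r1 r2 ->
  forall (T : A) (z : hom T R), zero_mor (r1 ∘ z) ->
  (zero_mor (q ∘ (r2 ∘ z)) <-> zero_mor (adj_unit adj R ∘ z)).
Hypothesis iP : joint_kernel i p (adj_unit adj E).

(** An element of the meet of the kernels of [p] and of the unit at [E] lifts locally
    to [P]; the lift lies in [K] because [f = p ∘ q], and the unit at [P] kills it
    because that unit factors through [q]. *)
Lemma meet_quotient_short_exact (R K CP CK N : A) (r1 r2 : hom R P)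
  (k : hom K P) (kappa : hom K R) (cP : hom CP P) (cK : hom CK K)
  (nK : hom N K) (nP : hom N CP) (j : hom CK N) :
  is_kernel_pair f r1 r2 -> is_kernel k f -> r2 ∘ kappa = k -> is_kernel kappa r1 ->
  is_kernel cP (adj_unit adj P) -> is_kernel cK (adj_unit adj R ∘ kappa) ->
  is_pullback k cP nK nP -> nK ∘ j = cK ->
  exists phi : hom N M, short_exact j phi.
Proof.
move=> rP kP kap2 kapP cPP cKP NP nj; have [pi0 ei0 i_mono i_lift] := iP.
have kq_zero (T : A) (y : hom T K) :
    zero_mor (q ∘ (k ∘ y)) <-> zero_mor (adj_unit adj R ∘ (kappa ∘ y)).
  by rewrite -kap2 -(composeA r2); apply: (q_zero rP); exact: kernel_zero kapP.
have unit_q (T : A) (y : hom T P) :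
    zero_mor (adj_unit adj E ∘ (q ∘ y)) -> zero_mor (adj_unit adj P ∘ y).
  have [g <-] : exists g, g ∘ q = adj_unit adj P.
    apply: (regular_epi_factor A_ptd A_reg A_proto q_reg) => W x qx0.
    have [|x' x'P] := kernel_lift (a := x) kP.
      by rewrite -pq -composeA; exact: zero_mor_compl.
    move: qx0; rewrite -x'P => /kq_zero/(unit_zero_map r2).
    by rewrite (compose_eq kap2).
  by rewrite -composeA; exact: unit_zero_factor.
have nK_mono : mono nK.
  move=> T a b ab; apply: (pullback_mono NP) => //; apply: (kernel_mono cPP).
  by rewrite !composeA -NP.1 -!composeA ab.
have [||phi phiE] := i_lift _ (q ∘ (k ∘ nK)).
- by rewrite (compose_eq pq); exact: kernel_zero kP.
- by apply: unit_zero_map; rewrite NP.1; exact: kernel_zero cPP.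
exists phi; apply: regular_epi_short_exact => //.
  have [T [t [x [t_reg xP]]]] := regular_epi_cover A_reg i q_reg.
  have [|y yP] := kernel_lift (a := x) kP.
    by rewrite -pq -composeA xP composeA; exact: zero_mor_compr.
  have [|z zP] := kernel_lift (a := x) cPP.
    by apply: unit_q; rewrite xP composeA; exact: zero_mor_compr.
  have [|n [n1 n2]] := pullback_lift (a := y) (b := z) NP; first by rewrite yP zP.
  apply: (@regular_epi_of_comp _ A_reg _ _ _ _ n).
  suff -> : phi ∘ n = t by [].
  by apply: i_mono; rewrite (compose_eq phiE) -!composeA n1 yP.
apply: kernelI => [||T y phiy0].
- apply: (mono_zero A_ptd i_mono); rewrite (compose_eq phiE) -!composeA nj.
  by apply/kq_zero; rewrite composeA; exact: cKP.1.
- by apply: (@mono_of_comp _ _ _ _ nK); rewrite nj; exact: kernel_mono cKP.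
have [|h hP] := kernel_lift (a := nK ∘ y) cKP.
  rewrite -composeA; apply/kq_zero.
  by rewrite (composeA k) (composeA q) -phiE -composeA; exact: zero_mor_compl.
by exists h; apply: nK_mono; rewrite (compose_eq nj).
Qed.

Lemma hopf_quotient_isomorphic (Q : A) :
  is_hopf_quotient adjI adj f Q -> isomorphic M Q.
Proof.
move=> [K [k [MP [mP [CP [cP [MK [mK [CK [cK [N [nK [nP [j [x [kP]]]]]]]]]]]]]]]].
move=> [mPP cPP] [mKP cKP] NP [nj jx].
have [R [r1 [r2 [kappa [rP kap2 kapP mKP']]]]] := relative_commutator_kernel A_ptd kP mKP.
have [d [d1 _]] := kernel_pair_diagonal rP.
have cPP' := unit_closure_kernel (absolute_commutator_kernel A_ptd mPP) cPP.
have cKP' := commutator_closure_kernel d1 kapP mKP' cKP.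
have [phi phiP] := meet_quotient_short_exact rP kP kap2 kapP cPP' cKP' NP nj.
by have [u [u_iso _]] := cokernel_isomorphic phiP.2 jx.2; exists u.
Qed.

Lemma hopf_quotient_joint_kernel : is_hopf_quotient adjI adj f M.
Proof.
have [K [k kP]] := kernel_ex A_lim A_ptd f.
have [R [r1 [r2 rP]]] := kernel_pair_ex A_lim f.
have [d [d1 _]] := kernel_pair_diagonal rP.
have [kappa [kap2 kapP]] := kernel_pair_kernel A_ptd rP kP.
have [MP [mP mPP]] := kernel_ex A_lim A_ptd (adj_unit adjI P).
have [MK [mK mKP]] := kernel_ex A_lim A_ptd (adj_unit adjI R ∘ kappa).
have [CP [cP cPP]] : exists CP (cP : hom CP P), is_closure adj mP cP.
  exact: closure_ex (regular_epi_short_exact A_ptd A_reg A_proto (adjI_reg P) mPP).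
have [K0 [a [ma _]]] := commutator_short_exact d1 kapP mKP.
have [CK [cK cKP]] : exists CK (cK : hom CK K), is_closure adj mK cK.
  exact: closure_ex ma.
have cPP' := unit_closure_kernel mPP cPP.
have cKP' := commutator_closure_kernel d1 kapP mKP cKP.
have [N [nK [nP NP]]] := pullback_ex A_lim k cP.
have [|c cE] := kernel_lift (a := k ∘ cK) cPP'.
  rewrite -kap2 -composeA; apply: unit_zero_map; rewrite composeA; exact: cKP'.1.
have [j [nj _]] := pullback_lift NP (esym cE).
have [phi phiP] := meet_quotient_short_exact rP kP kap2 kapP cPP' cKP' NP nj.
exists K, k, MP, mP, CP, cP, MK, mK, CK, cK, N, nK, nP, j, phi; split=> //.
  by split=> //; exact: absolute_commutator_of_kernel.
split=> //; exact: relative_commutator_of_kernel rP kap2 kapP mKP.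
Qed.

End Presentation.

End HopfFormula.

(** * The fundamental group *)

Theorem theorem7p4
  (A : category) (A_semi_abelian : semi_abelian A)
  (inB : A -> Prop)
  (I : functor A (full_sub inB))
  (adjI : adjunction I (incl inB))
  (B_birkhoff : birkhoff adjI)
  (inF : full_sub inB -> Prop)
  (F : functor (full_sub inB) (full_sub inF))
  (adjF : adjunction F (incl inF))
  (F_reflective : regular_epi_reflective adjF)
  (F_admissible : admissible adjF (@regular_epi (full_sub inB)))
  (F_protoadditive : protoadditive F)
  (B P : A) (f : hom P B) (f_presentation : projective_presentation f) :
  let adj := comp_adjunction adjI adjF in
  let HU := comp_functor (incl inB) (incl inF) in
  (exists G : full_sub inF, is_fundamental_group adj B G) /\
  (exists Q : A, is_hopf_quotient adjI adj f Q) /\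
  (forall (G : full_sub inF) (Q : A),
     is_fundamental_group adj B G -> is_hopf_quotient adjI adj f Q ->
     isomorphic (HU G) Q).
Proof.
move=> adj HU.
have [A_ptd A_exact A_proto _] := A_semi_abelian.
have [[A_lim _ _] _] := A_exact.
have [f_reg P_proj] := f_presentation.
have covers := composite_unit_covers A_ptd A_exact A_proto B_birkhoff F_reflective
  F_protoadditive.
have adj_reg := composite_unit_regular_epi A_exact B_birkhoff F_reflective.
have [_ B_reg] := B_birkhoff.1.
have F_ptd : pointed (full_sub inF).
  exact: reflective_pointed (reflective_pointed A_ptd B_reg) F_reflective.2.
have [E [q [p [q_reg pq p_norm q_zero q_univ]]]] :=
  normal_extension_reflection A_ptd A_exact A_proto covers f_reg.
have p_univ : weakly_universal_normal_extension adj p.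
  split=> // E' p' p'_norm; have [h hE] := P_proj _ _ _ f p'_norm.1.
  by have [u [_ pu]] := q_univ _ _ _ p'_norm hE; exists u.
have [M [i iP]] := joint_kernel_ex p (adj_unit adj E) A_lim A_ptd.
split.
  have HU_ff (Y Z : full_sub inF) (g : hom (HU Y) (HU Z)) : exists! h, fmap HU h = g.
    by exists g; split.
  have [G GP] := galois_group_ex A_ptd A_lim F_ptd HU_ff adj_reg p.
  by exists G, E, p.
split.
  exists M; exact: hopf_quotient_joint_kernel q_reg pq q_zero iP.
move=> G Q [E' [p' [p'_univ GP]]] QP.
have [i' i'P] := galois_group_joint_kernel A_ptd F_ptd p'_univ.1 GP.
apply: (isomorphic_trans (joint_kernel_isomorphic A_lim p'_univ p_univ i'P iP)).
exact: hopf_quotient_isomorphic q_reg pq q_zero iP _ QP.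
Qed.
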